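(* Let $(\mathcal{A},\mathcal{B},E,E')$ be a $C^*$-OVI probability space. If $x=x^*$ and $y=y^*$ are two selfadjoint elements of $\mathcal{A}$ that are infinitesimally free with respect to $(E,E')$, then for $b\in H^+(\mathcal{B})$ we have $$g_{x+y}(b)=\left[G_{x+y}'(b)\circ\omega_1'(b)\circ(G_{x+y}'(b))^{\langle-1\rangle}\right]\big(g_x(\omega_1(b))\big)+\left[G_{x+y}'(b)\circ\omega_2'(b)\circ(G_{x+y}'(b))^{\langle-1\rangle}\right]\big(g_y(\omega_2(b))\big),$$ where $\omega_1,\omega_2:H^+(\mathcal{B})\to H^+(\mathcal{B})$ are the subordination functions of the pair $(x,y)$.
   Context: A $C^*$-OVI (operator-valued infinitesimal) probability space $(\mathcal{A},\mathcal{B},E,E')$ consists of a unital $C^*$-algebra $\mathcal{A}$, a unital $C^*$-subalgebra $\mathcal{B}$ of $\mathcal{A}$, a completely positive linear map $E:\mathcal{A}\to\mathcal{B}$ with $E(b)=b$ and $E(b_1ab_2)=b_1E(a)b_2$, and a bounded selfadjoint linear map $E':\mathcal{A}\to\mathcal{B}$ with $E'(b_1ab_2)=b_1E'(a)b_2$ and $E'(1)=0$, for all $b,b_1,b_2\in\mathcal{B}$, $a\in\mathcal{A}$. Subalgebras $(\mathcal{A}_i)_{i\in I}$ of $\mathcal{A}$ containing $\mathcal{B}$ are infinitesimally free with respect to $(E,E')$ if for all $n\ge1$, all $i_1\neq i_2\neq\cdots\neq i_n$ in $I$ (consecutive indices distinct) and all $a_j\in\mathcal{A}_{i_j}$ with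 $E(a_j)=0$, one has $E(a_1\cdots a_n)=0$ and $E'(a_1\cdots a_n)=\sum_{j=1}^nE(a_1\cdots a_{j-1}E'(a_j)a_{j+1}\cdots a_n)$. Elements $x,y$ are infinitesimally free if the subalgebras generated by $\mathcal{B}\cup\{x\}$ and by $\mathcal{B}\cup\{y\}$ are. $H^+(\mathcal{B})=\{b\in\mathcal{B}:\operatorname{Im}(b)=\frac1{2i}(b-b^* )>0\}$, where $>0$ means positive and invertible. For $x=x^*\in\mathcal{A}$ and $b\in H^+(\mathcal{B})$: $G_x(b)=E[(b-x)^{-1}]$ is the Cauchy transform (and $G_x(b)$ is invertible), $F_x(b)=G_x(b)^{-1}$, and $g_x(b)=E'((b-x)^{-1})$ is the infinitesimal Cauchy transform. For a map $f$ on an open subset of $\mathcal{B}$, $f'(b):\mathcal{B}\to\mathcal{B}$ denotes the Fréchet derivative at $b$ (a linear map), and $\langle-1\rangle$ denotes the inverse with respect to composition. Subordination functions: if $x=x^*$ and $y=y^*$ are free with respect to $E$ over $\mathcal{B}$ (in particular if they are infinitesimally free), there is a unique pair of Fréchet analytic maps $\omega_1,\omega_2:H^+(\mathcal{B})\to H^+(\mathcal{B})$ such that for all $b\in H^+(\mathcal{B})$: (1) $\operatorname{Im}(\omega_j(b))\ge\operatorname{Im}(b)$ for $j=1,2$; (2) $F_x(\omega_1(b))+b=F_y(\omega_2(b))+b=\omega_1(b)+\omega_2(b)$; (3) $G_x(\omega_1(b))=G_y(\omega_2(b))=G_{x+y}(b)$.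
   Formalization: The formula is stated for those b in H^+(B) at which the linear map G'_{x+y}(b) has a compositional inverse; this can fail (A=C^2, B=C, E the average, E'=0, x=(1,-1), y=0, b=i), and then the right-hand side is undefined. *)

(* Defs.v *)
From HB Require Import structures.
From mathcomp Require Import all_boot all_order all_algebra.
From mathcomp Require Import complex.
From mathcomp Require Import all_classical all_reals all_analysis.

Set Implicit Arguments.
Unset Strict Implicit.
Unset Printing Implicit Defensive.

Import Order.TTheory GRing.Theory Num.Theory.
Import numFieldNormedType.Exports.

Local Open Scope classical_set_scope.
Local Open Scope ring_scope.

(* Unital C*-algebras.  The norm takes its (real, nonnegative) values in R[i],
   as for every normedModType over R[i].  The structure carries its own norm
   because a join of the library's normed modules and rings is impossible:
   it would compete with numDomainType.  The instances below equip every
   C*-algebra with its Banach space structure, `|a| being cnorm a.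
   The unitRing operations add no data up to classical logic: a \is a GRing.unit
   iff a has a two-sided inverse, and a^-1 is then that inverse. *)
HB.mixin Record isCStarAlgebra (R : realType) A of GRing.UnitAlgebra R[i] A := {
  star : A -> A ;
  starD : forall a b : A, star (a + b) = star a + star b ;
  starZ : forall (k : R[i]) (a : A), star (k *: a) = Num.conj k *: star a ;
  starM : forall a b : A, star (a * b) = star b * star a ;
  starK : involutive star ;
  cnorm : A -> R[i] ;
  cnormD : forall a b : A, cnorm (a + b) <= cnorm a + cnorm b ;
  cnormZ : forall (k : R[i]) (a : A), cnorm (k *: a) = `|k| * cnorm a ;
  cnorm0_eq0 : forall a : A, cnorm a = 0 -> a = 0 ;
  cnormM : forall a b : A, cnorm (a * b) <= cnorm a * cnorm b ;
  cnorm_star : forall a : A, cnorm (star a * a) = cnorm a ^+ 2 ;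
  cnorm_complete : forall u : nat -> A,
    (forall e : R[i], 0 < e ->
       exists N, forall m n, (N <= m)%N -> (N <= n)%N -> cnorm (u m - u n) < e) ->
    exists l : A, forall e : R[i], 0 < e ->
       exists N, forall n, (N <= n)%N -> cnorm (u n - l) < e
}.

#[short(type="cstarAlgType")]
HB.structure Definition CStarAlgebra (R : realType) :=
  {A of GRing.UnitAlgebra R[i] A & isCStarAlgebra R A}.

HB.instance Definition _ (R : realType) (A : cstarAlgType R) :=
  Lmodule_isNormed.Build R[i] A (@cnormD R A) (@cnormZ R A) (@cnorm0_eq0 R A).

Lemma cstar_cauchy_cvg (R : realType) (A : cstarAlgType R) (F : set_system A) :
  ProperFilter F -> cauchy F -> cvg F.
Proof.
move=> FF /cauchyP Fc.
pose eps n : R[i] := n.+1%:R^-1.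
have eps0 n : 0 < eps n by rewrite invr_gt0 ltr0Sn.
have eps_le m n : (m <= n)%N -> eps n <= eps m.
  by move=> mn; rewrite lef_pV2 ?posrE ?ltr0Sn// ler_nat ltnS.
have eps_small (e : R[i]) : 0 < e -> exists n, eps n < e.
  move=> e0; have eR : e \is Num.real by rewrite gtr0_real.
  have -> : e = (complex.Re e)%:C%C by rewrite RRe_real.
  have Re0 : 0 < complex.Re e by move: e0; rewrite -{1}(RRe_real eR) ltcR.
  have [n _ /(_ n (leqnn n)) /= hn] := near_infty_natSinv_lt (PosNum Re0).
  by exists n; rewrite /eps -(rmorph_nat (real_complex R)) -fmorphV ltcR.
have /choice[u Fu] : forall n, exists x, F (ball x (eps n)).
  by move=> n; exact: (Fc _ (eps0 n)).
have ball_normE (a b : A) e : ball a e b = (cnorm (a - b) < e) :> Prop.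
  by rewrite -ball_normE.
have split_eps (e : R[i]) : 0 < e -> exists N, eps N < e / 2.
  by move=> e0; apply: eps_small; rewrite divr_gt0.
have [e e0|l hl] := @cnorm_complete R A u.
  have [N hN] := split_eps e e0; exists N => m n Nm Nn.
  have [z [zm zn]] := filter_ex (filterI (Fu m) (Fu n)).
  have h := ball_triangle zm (ball_sym zn).
  rewrite ball_normE in h; apply: (lt_le_trans h).
  rewrite [leRHS](splitr e) lerD// ltW//; apply: le_lt_trans hN; exact: eps_le.
apply/cvg_ex; exists l; apply/cvg_ballP => e e0.
have e20 : 0 < e / 2 by rewrite divr_gt0.
have [N hN] := split_eps e e0; have [M hM] := hl _ e20.
pose n := maxn M N.
apply: filterS (Fu n) => z zn.
rewrite (splitr e); apply: (@ball_triangle _ _ (u n)).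
  by apply: ball_sym; rewrite ball_normE hM// leq_maxl.
apply: le_ball zn; rewrite ltW//; apply: le_lt_trans hN.
exact/eps_le/leq_maxr.
Qed.

HB.instance Definition _ (R : realType) (A : cstarAlgType R) :=
  Uniform_isComplete.Build A (@cstar_cauchy_cvg R A).

Section Positivity.
Context {R : realType} {A : cstarAlgType R}.

(* a >= 0 *)
Definition cpos (a : A) : Prop := exists c : A, a = star c * c.

Definition cle (a b : A) : Prop := cpos (b - a).

(* a > 0: positive and invertible *)
Definition cstrict_pos (a : A) : Prop := cpos a /\ a \is a GRing.unit.

Definition cIm (a : A) : A := (2 * 'i : R[i])^-1 *: (a - star a).

Definition Hplus : set A := [set b | cstrict_pos (cIm b)].

Definition mxstar n (X : 'M[A]_n) : 'M[A]_n := map_mx star X^T.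

(* positivity in the C*-algebra M_n(A) *)
Definition mxpos n (X : 'M[A]_n) : Prop :=
  exists Y : 'M[A]_n, X = mxstar Y *m Y.

End Positivity.

Definition completely_positive (R : realType) (A B : cstarAlgType R)
    (f : A -> B) : Prop :=
  forall n (X : 'M[A]_n), mxpos X -> mxpos (map_mx f X).

(* C*-OVI probability spaces.  The unital C*-subalgebra B of A is given as a
   C*-algebra together with its inclusion iota, an isometric unital
   *-homomorphism; this makes B a Banach space in its own right, so that
   Fréchet derivatives of maps between open subsets of B make sense. *)
Record COVI_space (R : realType) (A B : cstarAlgType R)
    (iota : {lrmorphism B -> A}) (E E' : {linear A -> B}) : Prop := {
  iota_star : forall b, iota (star b) = star (iota b) ;
  iota_norm : forall b, `|iota b| = `|b| ;
  E_cp : completely_positive E ;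
  E_id : forall b, E (iota b) = b ;
  E_bimod : forall b1 a b2, E (iota b1 * a * iota b2) = b1 * E a * b2 ;
  E'_bounded : exists M : R[i], forall a, `|E' a| <= M * `|a| ;
  E'_star : forall a, E' (star a) = star (E' a) ;
  E'_bimod : forall b1 a b2, E' (iota b1 * a * iota b2) = b1 * E' a * b2 ;
  E'_1 : E' 1 = 0
}.

Section OVI.
Context {R : realType} {A B : cstarAlgType R}.
Variables (iota : {lrmorphism B -> A}) (E E' : {linear A -> B}).

Definition inf_free_family (I : Type) (S : I -> set A) : Prop :=
  forall (n : nat) (i : 'I_n -> I) (a : 'I_n -> A),
    (0 < n)%N ->
    (forall j k : 'I_n, k = j.+1 :> nat -> i j <> i k) ->
    (forall j, S (i j) (a j)) ->
    (forall j, E (a j) = 0) ->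
    E (\prod_(j < n) a j) = 0 /\
    E' (\prod_(j < n) a j) =
      \sum_(j < n) E (\prod_(k < n) (if k == j then iota (E' (a j)) else a k)).

(* the (not necessarily closed) subalgebra of A generated by B and x *)
Definition alg_gen (x : A) : set A :=
  smallest [set M : set A | GRing.subalg_closed (mem M)] (range iota `|` [set x]).

Definition inf_free (x y : A) : Prop :=
  inf_free_family (fun i : bool => if i then alg_gen x else alg_gen y).

Definition Gtr (x : A) (b : B) : B := E ((iota b - x)^-1).

Definition Ftr (x : A) (b : B) : B := (Gtr x b)^-1.

Definition gtr (x : A) (b : B) : B := E' ((iota b - x)^-1).

(* Maps on the open set Hplus are represented by total functions, whose values
   outside Hplus are irrelevant; Fréchet analytic means complex Fréchet
   differentiable at each point of Hplus. *)
Record subordination (x y : A) (w1 w2 : B -> B) : Prop := {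
  sub_Hplus1 : forall b, Hplus b -> Hplus (w1 b) ;
  sub_Hplus2 : forall b, Hplus b -> Hplus (w2 b) ;
  sub_analytic1 : forall b, Hplus b -> differentiable w1 b ;
  sub_analytic2 : forall b, Hplus b -> differentiable w2 b ;
  sub_Im1 : forall b, Hplus b -> cle (cIm b) (cIm (w1 b)) ;
  sub_Im2 : forall b, Hplus b -> cle (cIm b) (cIm (w2 b)) ;
  sub_F1 : forall b, Hplus b -> Ftr x (w1 b) + b = w1 b + w2 b ;
  sub_F2 : forall b, Hplus b -> Ftr y (w2 b) + b = w1 b + w2 b ;
  sub_G1 : forall b, Hplus b -> Gtr x (w1 b) = Gtr (x + y) b ;
  sub_G2 : forall b, Hplus b -> Gtr y (w2 b) = Gtr (x + y) b
}.

End OVI.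

(* g is the inverse f^<-1> of f with respect to composition *)
Definition comp_inverse (T : Type) (f g : T -> T) : Prop :=
  cancel f g /\ cancel g f.

(* Main.v *)
Require Import Defs.
From HB Require Import structures.
From mathcomp Require Import all_boot all_order all_algebra.
From mathcomp Require Import complex ring lra.
From mathcomp Require Import all_classical all_reals all_analysis.
From Stdlib Require Ncring Ncring_tac.
Set Implicit Arguments.
Unset Strict Implicit.
Unset Printing Implicit Defensive.
Import Order.TTheory GRing.Theory Num.Theory.
Import numFieldNormedType.Exports.
Local Open Scope classical_set_scope.
Local Open Scope ring_scope.

(** Why the formula holds.

    Write G for the value of the Cauchy transform of x + y at b, put F = 1/G,
    and let X = (w1 b - x)^-1, Y = (w2 b - y)^-1.  By subordination
    E X = E Y = G and w1 b + w2 b - F = b, so u = X F - 1 and v = Y F - 1 are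
    centered and
      b - x - y = X^-1 + Y^-1 - F = X^-1 (1 - u v) G Y^-1,
    that is, (b - x - y)^-1 = (1 + v) (1 - u v)^-1 (1 + u) G: formally the sum
    of all alternating words in u and v, times G.

    The same computation is carried out in the dual numbers A + eps A, with
    eps central of square zero, after perturbing w1 b to w1 b + eps k1 and
    w2 b to w2 b + eps k2.  The resolvents become X - eps X k1 X and
    Y - eps Y k2 Y, and the identity above becomes an identity for
    (b + eps (k1 + k2) - x - y)^-1.  If k1 is chosen so that - E (X k1 X) is
    the infinitesimal Cauchy transform of x at w1 b, and k2 likewise for y,
    then u and v satisfy E u = 0 and E' (part without eps) = E (part with eps),
    and infinitesimal freeness makes the relation
    E' (part without eps) = E (part with eps) pass to all alternating words
    in u and v ([Phi_words]).  Once it passes to the resolvent of x + y, it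
    reads
      E' ((b - x - y)^-1) = - E ((b - x - y)^-1 (k1 + k2) (b - x - y)^-1),
    and the right-hand side is G' (b) (k1 + k2)
    ([infinitesimal_subordination]).  Finally the chain rule applied to
    G_x o w1 = G_(x+y) = G_y o w2 shows that k1 = w1' (b) (G' (b)^-1 (g_x (w1 b)))
    and k2 = w2' (b) (G' (b)^-1 (g_y (w2 b))) are admissible choices.

    The series for (1 - u v)^-1 need not converge.  It suffices, however, that
    1 - z u v stays invertible, with uniformly bounded inverse, for all z in [0, 1]: then (1 - u v)^-1 is
    reached from 1 by finitely many convergent Neumann expansions and is a
    norm limit of polynomials in u v ([resolvent_continuation]).  Put
    z = s^2, X_s = (1 - s) G + s X and Y_s = (1 - s) G + s Y.  Then
    (1 - z u v) G = X_s (X_s^-1 + Y_s^-1 - F) Y_s, the set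
    of T with Im (T^-1) >= Im (w1 b) is convex because it is an operator
    ball ([disc_convex]), and it contains X and G.  So the imaginary part of
    the middle factor is at least Im (w1 b) + Im (w2 b) - Im F = Im b > 0
    ([alternating_resolvent_bound]).

    The order theory behind these estimates is developed without spectra: a
    selfadjoint h is >= e when |t - h| <= t - e for some real t.  Square roots
    come from a majorized iteration, and the positivity of all c^* c is
    [kelley_vaught]. *)

(** * Deciding identities in noncommutative rings *)

#[global] Instance nzring_ops (T : nzRingType) :
  @Ncring.Ring_ops T 0 1 +%R *%R (fun x y => x - y) -%R eq := {}.

#[global] Instance nzring_ring (T : nzRingType) :
  @Ncring.Ring T 0 1 +%R *%R (fun x y => x - y) -%R eq (nzring_ops T).
Proof.
split; rewrite /Algebra_syntax.equality /Ncring.eq_notation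
  /Algebra_syntax.addition /Ncring.add_notation
  /Algebra_syntax.multiplication /Ncring.mul_notation
  /Algebra_syntax.subtraction /Ncring.sub_notation
  /Algebra_syntax.opposite /Ncring.opp_notation
  /Algebra_syntax.zero /Ncring.zero_notation
  /Algebra_syntax.one /Ncring.one_notation //.
- by split=> [x|x y ->|x y z -> ->].
- by move=> x y -> u v ->.
- by move=> x y -> u v ->.
- by move=> x y -> u v ->.
- by move=> x y ->.
- exact: add0r.
- exact: addrC.
- exact: addrA.
- exact: mul1r.
- exact: mulr1.
- exact: mulrA.
- by move=> *; exact: mulrDl.
- by move=> *; exact: mulrDr.
- exact: subrr.
Qed.

Ltac ncring := Ncring_tac.non_commutative_ring.

(** * The real-valued norm and real scalars *)

Section RealScalars.
Context {R : realType}.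
Implicit Types t s : R.
Lemma rc0 : real_complex R 0 = 0. Proof. exact: rmorph0. Qed.
Lemma rc1 : real_complex R 1 = 1. Proof. exact: rmorph1. Qed.
Lemma rcN t : real_complex R (- t) = - real_complex R t.
Proof. exact: rmorphN. Qed.
Lemma rcB t s : real_complex R (t - s) = real_complex R t - real_complex R s.
Proof. exact: rmorphB. Qed.
Lemma rcD t s : real_complex R (t + s) = real_complex R t + real_complex R s.
Proof. exact: rmorphD. Qed.
Lemma rcM t s : real_complex R (t * s) = real_complex R t * real_complex R s.
Proof. exact: rmorphM. Qed.
Lemma rcX t n : real_complex R (t ^+ n) = real_complex R t ^+ n.
Proof. exact: rmorphXn. Qed.

Lemma complex_gt0P (e : R[i]) : 0 < e -> exists2 r : R, 0 < r & e = real_complex R r.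
Proof.
move=> e0; have eE := RRe_real (gtr0_real e0).
by exists (complex.Re e); rewrite -?ltcR eE.
Qed.
End RealScalars.

Section Norm.
Context {R : realType} {A : cstarAlgType R}.
Implicit Types (a b c : A) (t s e : R).

Definition nrm a : R := complex.Re (cnorm a).

Definition rsc t : A := (real_complex R t)%:A.

Lemma normE a : `|a| = real_complex R (nrm a).
Proof. by rewrite /nrm -[cnorm a]/(`|a|) RRe_real// normr_real. Qed.

Lemma cnormE a : cnorm a = real_complex R (nrm a).
Proof. exact: normE. Qed.

Lemma nrm_ge0 a : 0 <= nrm a.
Proof. by rewrite -lecR -normE normr_ge0. Qed.

Lemma nrmD a b : nrm (a + b) <= nrm a + nrm b.
Proof. by rewrite -lecR rcD -!normE ler_normD. Qed.

Lemma nrmN a : nrm (- a) = nrm a.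
Proof. by apply: complexI; rewrite -!normE normrN. Qed.

Lemma nrmB a b : nrm (a - b) <= nrm a + nrm b.
Proof. by rewrite -(nrmN b) nrmD. Qed.

Lemma nrmC a b : nrm (a - b) = nrm (b - a).
Proof. by rewrite -nrmN opprB. Qed.

Lemma nrm_triangle a b c : nrm (a - c) <= nrm (a - b) + nrm (b - c).
Proof. by rewrite -[a - c](subrKA b) nrmD. Qed.

Lemma nrmM a b : nrm (a * b) <= nrm a * nrm b.
Proof. by rewrite -lecR rcM -!cnormE cnormM. Qed.

Lemma nrm_sstar a : nrm (star a * a) = nrm a ^+ 2.
Proof. by apply: complexI; rewrite rcX -!cnormE cnorm_star. Qed.

Lemma nrm0_eq0 a : nrm a = 0 -> a = 0.
Proof. by move=> h; apply: cnorm0_eq0; rewrite cnormE h. Qed.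

Lemma nrm0 : nrm (0 : A) = 0.
Proof. by apply: complexI; rewrite -normE normr0. Qed.

Lemma nrm_le0 a : nrm a <= 0 -> a = 0.
Proof. by move=> h; apply/nrm0_eq0/le_anti; rewrite h nrm_ge0. Qed.

Lemma nrmZ (k : R[i]) a : nrm (k *: a) = complex.Re `|k| * nrm a.
Proof.
by apply: complexI; rewrite rcM -!normE normrZ; congr (_ * _).
Qed.

Lemma nrmZr t a : nrm (real_complex R t *: a) = `|t| * nrm a.
Proof. by rewrite nrmZ normc_def/= expr0n addr0 sqrtr_sqr. Qed.

Lemma nrmZi a : nrm ('i *: a) = nrm a.
Proof. by rewrite nrmZ normCi mul1r. Qed.

Lemma star1 : star (1 : A) = 1.
Proof. by rewrite -[RHS]starK -[star 1 in RHS]mul1r starM starK mul1r. Qed.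

Lemma nrm1 : nrm (1 : A) = 1.
Proof.
have /eqP := nrm_sstar 1; rewrite star1 mulr1 expr2 -subr_eq0.
rewrite -[X in X - _]mulr1 -mulrBr mulf_eq0 => /orP[/eqP/nrm0_eq0/eqP|].
  by rewrite oner_eq0.
by rewrite subr_eq0 => /eqP <-.
Qed.

Lemma nrm_star a : nrm (star a) = nrm a.
Proof.
have le_star b : nrm b <= nrm (star b).
  have [->|n0] := eqVneq (nrm b) 0; first exact: nrm_ge0.
  have b0 : 0 < nrm b by rewrite lt0r n0 nrm_ge0.
  by rewrite -(ler_pM2r b0) -expr2 -nrm_sstar nrmM.
apply/le_anti/andP; split; last exact: le_star.
by rewrite -{2}[a]starK le_star.
Qed.

Lemma nrm_complete (u : nat -> A) :
  (forall e, 0 < e -> exists N, forall m n, (N <= m)%N -> (N <= n)%N ->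
     nrm (u m - u n) < e) ->
  exists l, forall e, 0 < e -> exists N, forall n, (N <= n)%N ->
     nrm (u n - l) < e.
Proof.
move=> cu; have [|l hl] := @cnorm_complete R A u.
  move=> _ /complex_gt0P[r r0 ->]; have [N hN] := cu r r0.
  by exists N => m n Nm Nn; rewrite cnormE ltcR hN.
exists l => e e0; have [|N hN] := hl (real_complex R e); first by rewrite ltcR.
by exists N => n Nn; rewrite -ltcR -cnormE hN.
Qed.

Lemma rsc0 : rsc 0 = 0. Proof. by rewrite /rsc rc0 scale0r. Qed.
Lemma rsc1 : rsc 1 = 1. Proof. by rewrite /rsc rc1 scale1r. Qed.
Lemma rscD t s : rsc (t + s) = rsc t + rsc s.
Proof. by rewrite /rsc rcD scalerDl. Qed.
Lemma rscN t : rsc (- t) = - rsc t.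
Proof. by rewrite /rsc rcN scaleNr. Qed.
Lemma rscB t s : rsc (t - s) = rsc t - rsc s.
Proof. by rewrite rscD rscN. Qed.
Lemma rscM t s : rsc (t * s) = rsc t * rsc s.
Proof. by rewrite /rsc rcM mulr_algl scalerA. Qed.
Lemma mul_rscl t a : rsc t * a = real_complex R t *: a.
Proof. exact: mulr_algl. Qed.
Lemma rscC t a : rsc t * a = a * rsc t.
Proof. by rewrite /rsc mulr_algl mulr_algr. Qed.
Lemma nrm_rsc t : nrm (rsc t) = `|t|.
Proof. by rewrite nrmZr nrm1 mulr1. Qed.
Lemma nrm_rscM t a : nrm (rsc t * a) = `|t| * nrm a.
Proof. by rewrite mul_rscl nrmZr. Qed.

Lemma star0 : star (0 : A) = 0.
Proof. by rewrite -(scale0r (0 : A)) starZ conjC0 !scale0r. Qed.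
Lemma starN a : star (- a) = - star a.
Proof. by apply/eqP; rewrite -addr_eq0 -starD addNr star0. Qed.
Lemma starB a b : star (a - b) = star a - star b.
Proof. by rewrite starD starN. Qed.
Lemma starZr t a : star (real_complex R t *: a) = real_complex R t *: star a.
Proof. by rewrite starZ conj_Creal// complex_real. Qed.
Lemma star_rsc t : star (rsc t) = rsc t.
Proof. by rewrite /rsc starZr star1. Qed.
Lemma starZi a : star ('i *: a) = - 'i *: star a.
Proof. by rewrite starZ conjCi. Qed.

Definition isc : A := 'i%:A.
Lemma isc2 : isc * isc = -1.
Proof. by rewrite mulr_algl scalerA -expr2 sqrCi scaleN1r. Qed.
Lemma iscC a : isc * a = a * isc.
Proof. by rewrite mulr_algl mulr_algr. Qed.
Lemma star_isc : star isc = - isc.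
Proof. by rewrite /isc starZi star1 scaleNr. Qed.
Lemma nrm_isc a : nrm (isc * a) = nrm a.
Proof. by rewrite mulr_algl nrmZi. Qed.

End Norm.
(** * Square roots *)

Section SquareRoot.
Context {R : realType} {A : cstarAlgType R}.
Implicit Types (a b c w : A) (t s e : R).

Lemma cvg_nrm_comm (u : nat -> A) l c :
  (forall e, 0 < e -> exists N, forall n, (N <= n)%N -> nrm (u n - l) < e) ->
  (forall n, GRing.comm c (u n)) -> GRing.comm c l.
Proof.
move=> ul cu; apply/subr0_eq/nrm_le0/ler_addgt0Pr => e e0; rewrite add0r.
have c0 : 0 < 2 * nrm c + 1 by have := nrm_ge0 c; lra.
have [N /(_ N (leqnn N)) hN] := ul _ (divr_gt0 e0 c0).
have -> : c * l - l * c = (u N - l) * c - c * (u N - l).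
  by rewrite mulrBl mulrBr (cu N); ncring.
apply: le_trans (nrmB _ _) _.
have h1 := nrmM (u N - l) c; have h2 := nrmM c (u N - l).
have {}hN : nrm (u N - l) * (2 * nrm c + 1) < e by rewrite -ltr_pdivlMr.
have := nrm_ge0 (u N - l); nra.
Qed.

(** Iterating y |-> (w + y^2) / 2 from 0 converges to 1 - sqrt (1 - w).  Every
    iterate is a polynomial in w with nonnegative coefficients, so for
    |w| <= 1 the norms of the increments are dominated by the increments of
    the same iteration run at the number 1; this covers the boundary case
    |w| = 1, where a geometric bound fails. *)
Fixpoint sqrt_iter w n : A :=
  if n is m.+1 then rsc 2^-1 * (w + sqrt_iter w m * sqrt_iter w m) else 0.

Fixpoint sqrt_majorant n : R :=
  if n is m.+1 then 2^-1 * (1 + sqrt_majorant m ^+ 2) else 0.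

Lemma comm_sqrt_iter w c n : GRing.comm c w -> GRing.comm c (sqrt_iter w n).
Proof.
move=> cw; elim: n => [|n ih] /=; first exact: commr0.
apply: commrM; first by rewrite /GRing.comm rscC.
by apply: commrD => //; apply: commrM.
Qed.

Lemma star_sqrt_iter w n : star w = w -> star (sqrt_iter w n) = sqrt_iter w n.
Proof.
move=> ws; elim: n => [|n ih] /=; first exact: star0.
by rewrite starM star_rsc starD starM ws ih rscC.
Qed.

Lemma sqrt_majorant_bound n : 0 <= sqrt_majorant n <= 1.
Proof.
elim: n => [|n /andP[h0 h1]] /=; first by rewrite lexx ler01.
by rewrite expr2; apply/andP; split; nra.
Qed.

Lemma sqrt_majorant_mono n : sqrt_majorant n <= sqrt_majorant n.+1.
Proof.
have /andP[h0 h1] := sqrt_majorant_bound n.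
by rewrite /= expr2; nra.
Qed.

Lemma sqrt_majorant_nd : {homo sqrt_majorant : m n / (m <= n)%N >-> m <= n}.
Proof. by apply: homo_leq; [exact: lexx | exact: le_trans | exact: sqrt_majorant_mono]. Qed.

Lemma nrm_sqrt_iter w n : nrm w <= 1 -> nrm (sqrt_iter w n) <= sqrt_majorant n.
Proof.
move=> w1; elim: n => [|n ih] /=; first by rewrite nrm0.
rewrite nrm_rscM ger0_norm ?invr_ge0// ler_wpM2l ?invr_ge0//.
apply: le_trans (nrmD _ _) _; apply: lerD => //.
apply: le_trans (nrmM _ _) _.
by rewrite expr2; apply: ler_pM => //; exact: nrm_ge0.
Qed.

(** Since the iterates commute, y_(n+2) - y_(n+1) factors as
    (y_(n+1) - y_n) (y_(n+1) + y_n) / 2, and the majorant obeys the same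
    recursion with equality. *)
Lemma sqrt_iter_step w n : nrm w <= 1 ->
  nrm (sqrt_iter w n.+1 - sqrt_iter w n) <= sqrt_majorant n.+1 - sqrt_majorant n.
Proof.
move=> w1; elim: n => [|n ih].
  rewrite /= mulr0 addr0 !subr0 nrm_rscM ger0_norm ?invr_ge0// expr0n addr0.
  by rewrite ler_wpM2l ?invr_ge0.
have cc : GRing.comm (sqrt_iter w n.+1) (sqrt_iter w n).
  by apply/comm_sqrt_iter/commr_sym/comm_sqrt_iter.
have -> : sqrt_iter w n.+2 - sqrt_iter w n.+1 =
  rsc 2^-1 * ((sqrt_iter w n.+1 - sqrt_iter w n) *
              (sqrt_iter w n.+1 + sqrt_iter w n)).
  rewrite -[sqrt_iter w n.+2]/(rsc _ * (w + sqrt_iter w n.+1 * sqrt_iter w n.+1)).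
  rewrite [X in _ - X]/(rsc _ * (w + sqrt_iter w n * sqrt_iter w n)) -mulrBr.
  by congr (_ * _); rewrite mulrBl !mulrDr cc; ncring.
rewrite nrm_rscM ger0_norm ?invr_ge0//.
have -> : sqrt_majorant n.+2 - sqrt_majorant n.+1 =
  2^-1 * ((sqrt_majorant n.+1 - sqrt_majorant n) *
          (sqrt_majorant n.+1 + sqrt_majorant n)).
  rewrite [LHS](_ : _ = 2^-1 * (1 + sqrt_majorant n.+1 ^+ 2) -
    2^-1 * (1 + sqrt_majorant n ^+ 2)) //; ring.
rewrite ler_wpM2l ?invr_ge0//; apply: le_trans (nrmM _ _) _.
apply: ler_pM => //; try exact: nrm_ge0.
apply: le_trans (nrmD _ _) _.
by apply: lerD; exact: nrm_sqrt_iter.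
Qed.

Lemma sqrt_iter_dist w m n : nrm w <= 1 -> (n <= m)%N ->
  nrm (sqrt_iter w m - sqrt_iter w n) <= sqrt_majorant m - sqrt_majorant n.
Proof.
move=> w1; elim: m => [|m ih].
  by rewrite leqn0 => /eqP->; rewrite !subrr nrm0.
rewrite leq_eqVlt ltnS => /predU1P[->|/ih {}ih]; first by rewrite !subrr nrm0.
apply: le_trans (nrm_triangle _ (sqrt_iter w m) _) _.
have := sqrt_iter_step m w1; lra.
Qed.

Lemma sqrt_iter_cvg w : nrm w <= 1 -> exists l : A, forall e, 0 < e ->
  exists N, forall n, (N <= n)%N -> nrm (sqrt_iter w n - l) < e.
Proof.
move=> w1; apply: nrm_complete => e e0.
have /cvgrPdist_lt cv : cvgn sqrt_majorant.
  apply: nondecreasing_is_cvgn; first exact: sqrt_majorant_nd.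
  by exists 1 => _ [n _ <-]; have /andP[] := sqrt_majorant_bound n.
have e2 : 0 < e / 2 by rewrite divr_gt0.
have [N _ hN] := cv _ e2; exists N => m n Nm Nn.
have hm := hN m Nm; have hn := hN n Nn; rewrite /= in hm hn.
move: hm hn; rewrite !ltr_distl => /andP[m1 m2] /andP[n1 n2].
have [mn|/ltnW nm] := leqP m n.
  by rewrite nrmC; apply: le_lt_trans (sqrt_iter_dist w1 mn) _; lra.
by apply: le_lt_trans (sqrt_iter_dist w1 nm) _; lra.
Qed.

(** The bound |y| <= 1 is kept because it makes the square root 1 - y itself
    nonnegative. *)
Lemma sqrt_one_sub w : star w = w -> nrm w <= 1 ->
  exists y, [/\ star y = y, nrm y <= 1, (1 - y) * (1 - y) = 1 - w &
    forall c, GRing.comm c w -> GRing.comm c y].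
Proof.
move=> ws w1; have [y yl] := sqrt_iter_cvg w1; exists y.
have y1 : nrm y <= 1.
  apply/ler_addgt0Pr => e e0; have [N /(_ N (leqnn N)) hN] := yl e e0.
  rewrite -[y](subrK (sqrt_iter w N)); apply: le_trans (nrmD _ _) _.
  have := nrm_sqrt_iter N w1; have /andP[_ ?] := sqrt_majorant_bound N.
  by move: hN; rewrite nrmC; lra.
have cy c : GRing.comm c w -> GRing.comm c y.
  by move=> cw; apply: cvg_nrm_comm yl _ => n; exact: comm_sqrt_iter.
split => //.
  apply/subr0_eq/nrm_le0/ler_addgt0Pr => e e0; rewrite add0r.
  have e2 : 0 < e / 2 by rewrite divr_gt0.
  have [N /(_ N (leqnn N)) hN] := yl _ e2.
  have -> : star y - y = (sqrt_iter w N - y) - star (sqrt_iter w N - y).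
    by rewrite starB star_sqrt_iter//; ncring.
  by apply: le_trans (nrmB _ _) _; rewrite nrm_star; lra.
(* Passing to the limit in the recursion, 2 y = w + y^2, which says that
   (1 - y)^2 = 1 - w. *)
suff fixy : y + y = w + y * y.
  have -> : (1 - y) * (1 - y) = 1 - (y + y) + y * y by ncring.
  by rewrite fixy; ncring.
apply/subr0_eq/nrm_le0/ler_addgt0Pr => e e0; rewrite add0r.
have e2 : 0 < e / 8 by rewrite divr_gt0.
have [N hN] := yl _ e2.
pose yN := sqrt_iter w N; pose yN1 := sqrt_iter w N.+1.
have hyN1 : yN1 + yN1 = w + yN * yN.
  rewrite /yN1 /= -/yN -mulrDl -rscD (_ : 2^-1 + 2^-1 = 1); first by rewrite rsc1 mul1r.
  by field.
have -> : y + y - (w + y * y) =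
  (yN - y) * yN + y * (yN - y) - (yN1 - y) - (yN1 - y).
  have -> : (yN - y) * yN + y * (yN - y) - (yN1 - y) - (yN1 - y) =
    yN * yN - (yN1 + yN1) + (y + y) - y * y by ncring.
  by rewrite hyN1; ncring.
have h0 := hN N (leqnn N); have h1 := hN N.+1 (leqnSn N).
rewrite -/yN in h0; rewrite -/yN1 in h1.
have b1 := nrmM (yN - y) yN; have b2 := nrmM y (yN - y).
have yN1b : nrm yN <= 1.
  by apply: le_trans (nrm_sqrt_iter N w1) _; have /andP[] := sqrt_majorant_bound N.
have g := nrm_ge0 (yN - y).
have b1' : nrm (yN - y) * nrm yN <= nrm (yN - y) by rewrite ler_piMr.
have b2' : nrm y * nrm (yN - y) <= nrm (yN - y) by rewrite ler_piMl.
apply: le_trans (nrmB _ _) _; apply: le_trans (lerD (nrmB _ _) (lexx _)) _.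
apply: le_trans (lerD (lerD (nrmD _ _) (lexx _)) (lexx _)) _.
lra.
Qed.

End SquareRoot.
(** * Positivity *)

Section Positivity.
Context {R : realType} {A : cstarAlgType R}.
Implicit Types (a b c d h k p r w : A) (t s e : R).

(** The order relation h >= e, phrased with the norm only: for selfadjoint h,
    |t - h| <= t - e with t large says that the spectrum of h lies in
    [e, 2 t - e].  Additivity is then the triangle inequality. *)
Definition lbd e h := star h = h /\ exists t, nrm (rsc t - h) <= t - e.

Lemma lbd_le e e' h : e' <= e -> lbd e h -> lbd e' h.
Proof. by move=> ee' [hs [t ht]]; split=> //; exists t; lra. Qed.

Lemma lbdD e e' h h' : lbd e h -> lbd e' h' -> lbd (e + e') (h + h').
Proof.
move=> [hs [t ht]] [hs' [t' ht']]; split; first by rewrite starD hs hs'.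
exists (t + t'); rewrite rscD.
have -> : rsc t + rsc t' - (h + h') = (rsc t - h) + (rsc t' - h') by ncring.
by apply: le_trans (nrmD _ _) _; lra.
Qed.

Lemma lbdD0 h h' : lbd 0 h -> lbd 0 h' -> lbd 0 (h + h').
Proof. by move=> hh hh'; rewrite -[0]addr0; exact: lbdD. Qed.

Lemma lbdZ s e h : 0 <= s -> lbd e h -> lbd (s * e) (rsc s * h).
Proof.
move=> s0 [hs [t ht]]; split; first by rewrite starM star_rsc hs rscC.
exists (s * t); rewrite rscM -mulrBr nrm_rscM ger0_norm// -mulrBr.
by rewrite ler_wpM2l.
Qed.

Lemma lbdZ0 s h : 0 <= s -> lbd 0 h -> lbd 0 (rsc s * h).
Proof. by move=> s0 /(lbdZ s0); rewrite mulr0. Qed.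

Lemma lbd_shift s e h : lbd e h -> lbd (e + s) (h + rsc s).
Proof.
move=> [hs [t ht]]; split; first by rewrite starD star_rsc hs.
exists (t + s); rewrite rscD.
have -> : rsc t + rsc s - (h + rsc s) = rsc t - h by ncring.
lra.
Qed.

Lemma nrm_lbd t h : star h = h -> nrm h <= t -> lbd 0 (rsc t - h).
Proof.
move=> hs ht; split; first by rewrite starB star_rsc hs.
by exists t; rewrite opprB addrC subrK subr0.
Qed.

Lemma lbd0 : lbd 0 (0 : A).
Proof. by split; [exact: star0|exists 0; rewrite rsc0 subrr nrm0 subrr]. Qed.

Lemma unit_inverse a b : a * b = 1 -> b * a = 1 -> a \is a GRing.unit /\ a^-1 = b.
Proof.
move=> ab ba; have ua : a \is a GRing.unit by apply/unitrP; exists b.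
by split=> //; rewrite -[LHS]mulr1 -ab mulKr.
Qed.

Lemma star_unit a : a \is a GRing.unit -> star a \is a GRing.unit.
Proof.
move=> ua; apply/unitrP; exists (star a^-1).
by rewrite -!starM mulrV// mulVr// star1.
Qed.

Lemma starV a : a \is a GRing.unit -> star a^-1 = (star a)^-1.
Proof.
move=> ua.
by have [] := @unit_inverse (star a) (star a^-1); rewrite -?starM ?mulrV ?mulVr ?star1.
Qed.

(** The partial sums of the geometric series are Cauchy, and the bound follows
    from v = 1 + w v for the inverse v. *)
Lemma neumann w t : nrm w <= t -> t < 1 ->
  1 - w \is a GRing.unit /\ nrm (1 - w)^-1 <= (1 - t)^-1.
Proof.
move=> wt t1; have t0 : 0 <= t by apply: le_trans wt; exact: nrm_ge0.
have wX n : nrm (w ^+ n) <= t ^+ n.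
  elim: n => [|n ih]; first by rewrite !expr0 nrm1.
  by rewrite !exprS; apply: le_trans (nrmM _ _) _; apply: ler_pM => //; exact: nrm_ge0.
have tX : forall e, 0 < e -> exists N, forall n, (N <= n)%N -> t ^+ n < e.
  move=> e e0; have /cvgrPdist_lt/(_ e e0)[N _ hN] : (t ^+ n @[n --> \oo] --> 0)%classic.
    by apply: cvg_expr; rewrite ger0_norm.
  exists N => n /hN /=; rewrite sub0r normrN ger0_norm//; exact: exprn_ge0.
pose u n := \sum_(i < n) w ^+ i.
have uE n : (1 - w) * u n = 1 - w ^+ n.
  by rewrite /u -opprB mulNr -subrX1 opprB.
have uE' n : u n * (1 - w) = 1 - w ^+ n.
  by rewrite -uE; apply/commr_sym/commr_sum => i _; apply/commr_sym/commrB;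
     [exact: commr1|exact/commr_sym/commrX].
have ud m n : (n <= m)%N -> nrm (u m - u n) <= (t ^+ n - t ^+ m) / (1 - t).
  elim: m => [|m ih]; first by rewrite leqn0 => /eqP->; rewrite !subrr nrm0 mul0r.
  rewrite leq_eqVlt ltnS => /predU1P[->|/ih {}ih].
    by rewrite !subrr nrm0 mul0r.
  apply: le_trans (nrm_triangle _ (u m) _) _.
  rewrite {1}/u big_ord_recr/= -/(u m) addrAC subrr add0r.
  have -> : (t ^+ n - t ^+ m.+1) / (1 - t) = t ^+ m + (t ^+ n - t ^+ m) / (1 - t).
    by rewrite exprS; field; lra.
  exact: lerD.
have [|v uv] := @nrm_complete R A u.
  move=> e e0; have e1 : 0 < e * (1 - t) by rewrite mulr_gt0// subr_gt0.
  have [N hN] := tX _ e1; exists N => m n Nm Nn.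
  have key (k l : nat) : (N <= l)%N -> (l <= k)%N -> nrm (u k - u l) < e.
    move=> Nl lk; apply: le_lt_trans (ud _ _ lk) _.
    rewrite ltr_pdivrMr ?subr_gt0//; have := hN l Nl.
    by have := exprn_ge0 k t0; lra.
  by have [mn|/ltnW nm] := leqP m n; [rewrite nrmC|]; exact: key.
have c0 : 0 < nrm (1 - w) + 1 by have := nrm_ge0 (1 - w); lra.
have inv1 : (1 - w) * v = 1 /\ v * (1 - w) = 1.
  split; apply/subr0_eq/nrm_le0/ler_addgt0Pr => e e0; rewrite add0r;
  have e2 : 0 < e / 2 by [rewrite divr_gt0];
  have [N1 hN1] := uv _ (divr_gt0 e2 c0); have [N2 hN2] := tX _ e2;
  have {hN1} := hN1 _ (leq_maxl N1 N2); have {hN2} := hN2 _ (leq_maxr N1 N2);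
  set n := maxn N1 N2 => h2; rewrite ltr_pdivlMr// => h1;
  have g := nrm_ge0 (u n - v).
    have -> : (1 - w) * v - 1 = - ((1 - w) * (u n - v)) - w ^+ n.
      by rewrite [in RHS]mulrBr uE; ncring.
    apply: le_trans (nrmB _ _) _; rewrite nrmN.
    by have := nrmM (1 - w) (u n - v); have := wX n; nra.
  have -> : v * (1 - w) - 1 = - ((u n - v) * (1 - w)) - w ^+ n.
    by rewrite [(_ - v) * _]mulrBl uE'; ncring.
  apply: le_trans (nrmB _ _) _; rewrite nrmN.
  by have := nrmM (u n - v) (1 - w); have := wX n; nra.
have [uw vE] := unit_inverse inv1.1 inv1.2; split=> //; rewrite vE.
have vw : v = 1 + w * v by rewrite -{1}inv1.1; ncring.
have := nrmD 1 (w * v); rewrite -vw nrm1; have := nrmM w v; have := nrm_ge0 v.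
move=> v0 h1 h2; rewrite -[leRHS]mul1r ler_pdivlMr ?subr_gt0//; nra.
Qed.

(** h = t (1 - (t - h) / t), where the norm of (t - h) / t is at most
    1 - e / t < 1. *)
Lemma lbd_unit e h : 0 < e -> lbd e h ->
  h \is a GRing.unit /\ nrm h^-1 <= e^-1.
Proof.
move=> e0 [hs [t ht]].
have t0 : 0 < t by have := nrm_ge0 (rsc t - h); lra.
have tn0 : t != 0 by rewrite gt_eqF.
have hw : nrm (rsc t^-1 * (rsc t - h)) <= t^-1 * (t - e).
  by rewrite nrm_rscM gtr0_norm ?invr_gt0// ler_pM2l ?invr_gt0.
have [|u ub] := neumann hw.
  by rewrite mulrC ltr_pdivrMr//; lra.
have hE : h = rsc t * (1 - rsc t^-1 * (rsc t - h)).
  by rewrite mulrBr mulrA -rscM divff// rsc1 mulr1 mul1r subKr.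
have [ut tV] : (rsc t : A) \is a GRing.unit /\ (rsc t)^-1 = rsc t^-1 :> A.
  by apply: unit_inverse; rewrite -?rscM ?divff ?mulVf ?rsc1.
split; first by rewrite hE unitrMr.
rewrite hE invrM// tV -rscC nrm_rscM gtr0_norm ?invr_gt0//.
have ti : 0 <= t^-1 by rewrite invr_ge0 ltW.
rewrite mulrC; apply: le_trans (ler_wpM2r ti ub) _.
rewrite le_eqVlt; apply/orP; left; apply/eqP.
by field; rewrite tn0 /= gt_eqF//=; lra.
Qed.

Lemma lbd_sqrt h : lbd 0 h -> exists r, [/\ star r = r, lbd 0 r, r * r = h &
  forall c, GRing.comm c h -> GRing.comm c r].
Proof.
move=> [hs [t]]; rewrite subr0 => ht.
have t0 : 0 <= t by apply: le_trans ht; exact: nrm_ge0.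
move: t0; rewrite le_eqVlt => /predU1P[t0|t0].
  move: ht; rewrite -t0 rsc0 sub0r nrmN => /nrm_le0 ->.
  by exists 0; split; [exact: star0|exact: lbd0|rewrite mul0r|].
have tn0 : t != 0 by rewrite gt_eqF.
pose w := 1 - rsc t^-1 * h.
have wE : w = rsc t^-1 * (rsc t - h).
  by rewrite mulrBr -rscM mulVf// rsc1.
have [||y [ys y1 yy yc]] := @sqrt_one_sub R A w.
- by rewrite /w starB star1 starM star_rsc hs rscC.
- by rewrite wE nrm_rscM gtr0_norm ?invr_gt0// mulrC ler_pdivrMr// mul1r.
have st0 : 0 <= Num.sqrt t by exact: sqrtr_ge0.
have sE : star (rsc (Num.sqrt t) * (1 - y)) = rsc (Num.sqrt t) * (1 - y).
  by rewrite starM star_rsc starB star1 ys rscC.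
exists (rsc (Num.sqrt t) * (1 - y)); split => //.
- split=> //; exists (Num.sqrt t); rewrite subr0.
  rewrite [X in nrm X](_ : _ = rsc (Num.sqrt t) * y); last by ncring.
  by rewrite nrm_rscM ger0_norm// ler_piMr.
- rewrite mulrA -[_ * _ * rsc _]mulrA -rscC mulrA -mulrA yy -rscM -expr2.
  by rewrite sqr_sqrtr ?ltW// /w subKr mulrA -rscM divff// rsc1 mul1r.
- move=> c ch; apply: commrM; first by rewrite /GRing.comm rscC.
  apply: commrB; first exact: commr1.
  apply: yc; apply: commrB; first exact: commr1.
  by apply: commrM => //; rewrite /GRing.comm rscC.
Qed.

(** The element s + i r is sqrt a times a unitary, so its square and the
    adjoint of its square have norm at most a; their half-sum is
    s^2 - r^2 = a - 2 r^2. *)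
Lemma nrm_circle r (s : A) (a : R) : star r = r -> star s = s -> GRing.comm r s -> 0 <= a ->
  r * r + s * s = rsc a -> nrm (rsc a - (r * r + r * r)) <= a.
Proof.
move=> rs ss crs a0 rsa.
pose U := s + isc * r.
have Us : star U = s - isc * r.
  by rewrite /U starD ss starM rs star_isc mulrN -iscC.
have nU : nrm U ^+ 2 = a.
  rewrite -nrm_sstar -[RHS]ger0_norm// -(@nrm_rsc R A) -rsa Us /U.
  congr nrm; rewrite mulrBl !mulrDr !mulrA -[isc * r * isc]mulrA -iscC mulrA isc2.
  by rewrite -[s * isc]iscC -[isc * s * r]mulrA -crs; ncring.
have e2 : U * U + star U * star U =
    (rsc a - (r * r + r * r)) + (rsc a - (r * r + r * r)).
  have -> : U * U + star U * star U = s * s + s * s + isc * r * (isc * r) + isc * r * (isc * r).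
    by rewrite Us /U; ncring.
  have -> : isc * r * (isc * r) = - (r * r).
    by rewrite mulrA -[isc * r * isc]mulrA -iscC mulrA isc2; ncring.
  by rewrite -rsa; ncring.
have h : nrm (U * U + star U * star U) <= a + a.
  apply: le_trans (nrmD _ _) _; apply: lerD; apply: le_trans (nrmM _ _) _;
  by rewrite -expr2 ?nrm_star nU.
move: h; rewrite e2 -[X in nrm X]mul1r mulrDr -mulrDl.
by rewrite -rsc1 -rscD nrm_rscM ger0_norm; lra.
Qed.

(** Apply the previous lemma with a = |r|^2 and s = sqrt (a - r^2): it centers
    r^2 at a / 2 with radius a / 2. *)
Lemma sq_lbd r : star r = r -> lbd 0 (r * r).
Proof.
move=> rs; have rrs : star (r * r) = r * r by rewrite starM rs.
pose a := nrm r ^+ 2; have a0 : 0 <= a by rewrite sqr_ge0.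
have [|s [ss _ s2 sc]] := @lbd_sqrt (rsc a - r * r).
  by apply: nrm_lbd => //; apply: le_trans (nrmM _ _) _; rewrite -expr2.
split=> //; exists (a / 2).
have crs : GRing.comm r s.
  apply: sc; apply: commrB; first by rewrite /GRing.comm rscC.
  by rewrite /GRing.comm mulrA.
have := nrm_circle rs ss crs a0; rewrite s2 addrC subrK => /(_ erefl).
have -> : rsc a - (r * r + r * r) = rsc 2 * (rsc (a / 2) - r * r).
  rewrite mulrBr -rscM (_ : 2 * (a / 2) = a); last by field.
  by rewrite (_ : 2 = 1 + 1 :> R)// rscD rsc1; ncring.
by rewrite nrm_rscM ger0_norm//; lra.
Qed.

Lemma lbd_nrm_le p t : 0 <= t -> lbd 0 p -> lbd 0 (rsc t - p) -> nrm p <= t.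
Proof.
move=> t0 /lbd_sqrt[r [rs _ r2 _]] /lbd_sqrt[s [ss _ s2 sc]].
have crs : GRing.comm r s.
  apply: sc; apply: commrB; first by rewrite /GRing.comm rscC.
  by rewrite -r2 /GRing.comm mulrA.
have := nrm_circle rs ss crs t0; rewrite r2 s2 addrC subrK => /(_ erefl) h.
have := nrmB (rsc t) (rsc t - (p + p)); rewrite nrm_rsc ger0_norm// subKr.
rewrite -[X in nrm X]mul1r mulrDr -mulrDl -rsc1 -rscD nrm_rscM ger0_norm; lra.
Qed.

(** For n > |p^-1| the element 1 - p^-1 / n has a square root q, which commutes
    with r = sqrt p, and p - 1 / n = (q r)^2. *)
Lemma lbd_of_unit p : lbd 0 p -> p \is a GRing.unit -> exists2 e, 0 < e & lbd e p.
Proof.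
move=> p0 up; have [r [rs _ r2 rc]] := lbd_sqrt p0.
pose n := nrm p^-1 + 1; have n0 : 0 < n by have := nrm_ge0 p^-1; rewrite /n; lra.
pose w := rsc n^-1 * p^-1.
have [||y [ys y1 yy yc]] := @sqrt_one_sub R A w.
- by rewrite /w starM star_rsc starV// p0.1 rscC.
- rewrite /w nrm_rscM gtr0_norm ?invr_gt0// mulrC ler_pdivrMr// /n; lra.
have cry : GRing.comm r (1 - y).
  apply: commrB; first exact: commr1.
  apply: yc; apply: commrM; first by rewrite /GRing.comm rscC.
  by apply: commrV; rewrite -r2 /GRing.comm mulrA.
exists n^-1; first by rewrite invr_gt0.
have -> : p = (1 - y) * r * ((1 - y) * r) + rsc n^-1.
  rewrite -mulrA [r * _]mulrA cry mulrA mulrA yy -mulrA r2 mulrBl mul1r.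
  by rewrite /w -mulrA mulVr// mulr1 subrK.
rewrite -{1}[n^-1]add0r; apply/lbd_shift/sq_lbd.
by rewrite starM rs starB star1 ys cry.
Qed.

(** If c inverts 1 + a b, then 1 - b c a inverts 1 + b a; this is how the
    nonzero spectra of a b and b a are compared. *)
Lemma unit_1addM a b : 1 + a * b \is a GRing.unit -> 1 + b * a \is a GRing.unit.
Proof.
move=> u; have i1 := mulrV u; have i2 := mulVr u.
set v := (1 + a * b)^-1 in i1 i2.
have [] := @unit_inverse (1 + b * a) (1 - b * v * a) => //.
  have -> : (1 + b * a) * (1 - b * v * a) = 1 + b * a - b * ((1 + a * b) * v) * a.
    by ncring.
  by rewrite i1; ncring.
have -> : (1 - b * v * a) * (1 + b * a) = 1 + b * a - b * (v * (1 + a * b)) * a.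
  by ncring.
by rewrite i2; ncring.
Qed.

(** The sum of d^* d and d d^* is nonnegative, being half the sum of the squares
    of the selfadjoint elements d + d^* and i (d - d^* ).  So d^* d = - k^2
    makes d d^* nonnegative, hence 1 + t d d^* and therefore 1 - t k^2
    invertible for all t >= 0.  At t = 1 / |k^2| the nonnegative element
    1 - t k^2 is invertible, so bounded below by some e > 0; then
    |t k^2| <= 1 - e, against the choice of t. *)
Lemma sstar_nonpos_eq0 d k : star k = k -> star d * d = - (k * k) -> d = 0.
Proof.
move=> ks dk.
have dd : lbd 0 (d * star d).
  pose p := d + star d; pose q := isc * (d - star d).
  have ps : star p = p by rewrite /p starD starK addrC.
  have qs : star q = q.
    by rewrite /q starM starB starK star_isc iscC; ncring.
  have pq : p * p + q * q = d * star d + d * star d + star d * d + star d * d.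
    have -> : q * q = - ((d - star d) * (d - star d)).
      rewrite /q mulrA -[isc * _ * isc]mulrA -iscC mulrA isc2; ncring.
    by rewrite /p; ncring.
  have -> : d * star d = rsc 2^-1 * (p * p + q * q + k * k + k * k).
    have -> : p * p + q * q + k * k + k * k = rsc 2 * (d * star d).
      by rewrite pq dk (_ : 2 = 1 + 1 :> R)// rscD rsc1; ncring.
    by rewrite mulrA -rscM mulVf ?rsc1 ?mul1r.
  apply: lbdZ0; first by rewrite invr_ge0.
  by do !apply: lbdD0; exact: sq_lbd.
pose Q := nrm (k * k).
suff Q0 : Q = 0.
  apply/nrm0_eq0/eqP; rewrite -sqrf_eq0 -nrm_sstar dk nrmN; exact/eqP.
apply/eqP; case: eqVneq => // Qn0.
have Qp : 0 < Q by rewrite lt0r Qn0 nrm_ge0.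
have kks : star (k * k) = k * k by rewrite starM ks.
have Qi : 0 <= Q^-1 by rewrite invr_ge0 ltW.
have nQ : nrm (rsc Q^-1 * (k * k)) = 1.
  by rewrite nrm_rscM ger0_norm// mulVf.
pose p := 1 - rsc Q^-1 * (k * k).
have p0 : lbd 0 p.
  rewrite /p -rsc1; apply: nrm_lbd; last by rewrite nQ.
  by rewrite starM kks star_rsc rscC.
have up : p \is a GRing.unit.
  have -> : p = 1 + star d * (rsc Q^-1 * d).
    by rewrite mulrA -rscC -mulrA dk /p; ncring.
  apply: unit_1addM; rewrite -mulrA.
  have h : lbd 1 (rsc Q^-1 * (d * star d) + rsc 1).
    by have := lbd_shift 1 (lbdZ0 Qi dd); rewrite add0r.
  by have [|] := lbd_unit _ h; rewrite ?ltr01// rsc1 addrC.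
have [e e0 [_ [t ht]]] := lbd_of_unit p0 up.
have h : lbd 0 (rsc (1 - e) - rsc Q^-1 * (k * k)).
  split; first by rewrite starB star_rsc starM kks star_rsc rscC.
  exists (t - e); rewrite [X in nrm X](_ : _ = rsc t - p) ?subr0//.
  by rewrite /p !rscB rsc1; ncring.
have h' : lbd 0 (rsc Q^-1 * (k * k)) by apply: lbdZ0 => //; exact: sq_lbd.
have [e1|e1] := leP e 1.
  have := lbd_nrm_le _ h' h; rewrite nQ subr_ge0 => /(_ e1); lra.
have : lbd 0 (rsc (1 - e) : A).
  by rewrite -[rsc _](subrK (rsc Q^-1 * (k * k))); exact: lbdD0.
case=> _ [t' ht']; have := ht'; rewrite -rscB nrm_rsc subr0 => h2.
have := le_trans (ler_norm _) h2; lra.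
Qed.

(** With h = c^* c and m = |h| = sqrt (h^2), the element n = m - h is twice the
    negative part of h, and d = c n satisfies d^* d = n h n = - n m n, the
    opposite of a square.  Hence d = 0, which forces n = 0, so h = m. *)
Lemma kelley_vaught c : lbd 0 (star c * c).
Proof.
pose h := star c * c; have hs : star h = h by rewrite /h starM starK.
have [m [ms m0 m2 mc]] := lbd_sqrt (sq_lbd hs).
have chm : h * m = m * h by apply: mc; rewrite /GRing.comm mulrA.
have [r [rs _ r2 rc]] := lbd_sqrt m0.
pose n := m - h.
have ns : star n = n by rewrite starB ms hs.
have crn : n * r = r * n by apply: rc; rewrite /GRing.comm /n mulrBl mulrBr chm.
have nmh : n * (m + h) = 0.
  rewrite /n (_ : _ * _ = m * m - h * h + m * h - h * m); last by ncring.
  by rewrite m2 chm; ncring.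
have c0 : c * n = 0.
  apply: (@sstar_nonpos_eq0 _ (r * n)); first by rewrite starM ns rs.
  rewrite starM ns -[r * n in RHS]crn.
  have -> : n * star c * (c * n) = n * h * n by rewrite /h; ncring.
  have -> : n * r * (n * r) = n * m * n.
    by rewrite -r2 {2}crn; ncring.
  by apply/eqP; rewrite -addr_eq0 -mulrDl -mulrDr [h + m]addrC nmh mul0r.
have hn : h * n = 0 by rewrite /h -mulrA c0 mulr0.
have nh : n * h = 0 by rewrite -ns -hs -starM hn star0.
have nn : n * n = 0.
  move: nmh; rewrite mulrDr nh addr0 => nm.
  by rewrite {2}/n mulrBr nm nh subr0.
suff /subr0_eq mh : n = 0 by rewrite -/h -mh.
by apply/nrm0_eq0/eqP; rewrite -sqrf_eq0 -nrm_sstar ns nn nrm0.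
Qed.

Lemma lbd_conj d h : lbd 0 h -> lbd 0 (star d * h * d).
Proof.
move=> /lbd_sqrt[r [rs _ <- _]].
have -> : star d * (r * r) * d = star (r * d) * (r * d).
  by rewrite starM rs; ncring.
exact: kelley_vaught.
Qed.

End Positivity.
(** * Imaginary parts and resolvents *)

Section ImaginaryPart.
Context {R : realType} {A : cstarAlgType R}.
Implicit Types (a b c d h k p r w T P Q : A) (t s e : R).

Lemma star_cIm T : star (cIm T) = cIm T.
Proof.
rewrite /cIm starZ starB starK -opprB scalerN -scaleNr; congr (_ *: _).
by rewrite fmorphV rmorphM /= conjCi conjC_nat mulrN invrN opprK.
Qed.

Lemma cartesian T : T = rsc 2^-1 * (T + star T) + isc * cIm T.
Proof.
rewrite /cIm mul_rscl mulr_algl scalerA.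
have -> : 'i * (2 * 'i)^-1 = real_complex R 2^-1 :> R[i].
  rewrite invfM mulrCA mulfV ?neq0Ci// mulr1 fmorphV; congr (_^-1).
  by rewrite rmorph_nat.
rewrite -scalerDr addrACA subrr addr0 -mul_rscl -[X in X + X]mul1r -mulrDl.
by rewrite mulrA -rsc1 -rscD -rscM (_ : 2^-1 * (1 + 1) = 1) ?rsc1 ?mul1r//; field.
Qed.

Lemma cImD T P : cIm (T + P) = cIm T + cIm P.
Proof. by rewrite /cIm -scalerDr starD; congr (_ *: _); ncring. Qed.

Lemma cImN T : cIm (- T) = - cIm T.
Proof. by rewrite /cIm -scalerN starN; congr (_ *: _); ncring. Qed.

Lemma cImB T P : cIm (T - P) = cIm T - cIm P.
Proof. by rewrite cImD cImN. Qed.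

Lemma cImZr s T : cIm (rsc s * T) = rsc s * cIm T.
Proof.
by rewrite /cIm starM star_rsc -rscC -mulrBr !mul_rscl !scalerA mulrC.
Qed.

Lemma cIm_sa T : star T = T -> cIm T = 0.
Proof. by move=> ts; rewrite /cIm ts subrr scaler0. Qed.

Lemma cIm_inv T : T \is a GRing.unit ->
  cIm T^-1 = - (star T^-1 * cIm T * T^-1).
Proof.
move=> uT; rewrite /cIm -scalerAr -scalerAl -scalerN; congr (_ *: _).
rewrite mulrBr mulrBl -mulrA mulrV// starV// mulVr ?star_unit//; ncring.
Qed.

(** Write T = k + i h with h >= e, and take t with |t - h| <= t - e.  The inverse
    of N = k + i t has norm at most 1 / t because N^* N = k^2 + t^2 >= t^2,
    and T = N (1 - N^-1 i (t - h)) is then inverted by a Neumann series. *)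
Lemma cIm_lbd_unit e T : 0 < e -> lbd e (cIm T) ->
  T \is a GRing.unit /\ nrm T^-1 <= e^-1.
Proof.
move=> e0 [_ [t ht]].
have t0 : 0 < t by have := nrm_ge0 (rsc t - cIm T); lra.
have tn0 : t != 0 by rewrite gt_eqF.
pose k := rsc 2^-1 * (T + star T).
have ks : star k = k by rewrite /k starM starD starK star_rsc -rscC addrC.
have Tk : T = k + isc * cIm T := cartesian T.
clearbody k; pose N := k + isc * rsc t; pose N' := k - isc * rsc t.
have Ns : star N = N'.
  by rewrite starD ks starM star_rsc star_isc mulrN rscC.
have ct : isc * rsc t * k = k * (isc * rsc t).
  by rewrite -mulrA [rsc t * k]rscC !mulrA iscC.
have tt : isc * rsc t * (isc * rsc t) = - rsc (t ^+ 2) :> A.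
  by rewrite mulrA -[isc * _ * isc]mulrA -iscC mulrA isc2 expr2 rscM; ncring.
pose m := k * k + rsc (t ^+ 2).
have NN' : N * N' = m.
  rewrite /N /N' (_ : _ * _ = k * k + isc * rsc t * k - k * (isc * rsc t)
    - isc * rsc t * (isc * rsc t)); last by ncring.
  by rewrite ct tt /m; ncring.
have N'N : N' * N = m.
  rewrite /N /N' (_ : _ * _ = k * k - isc * rsc t * k + k * (isc * rsc t)
    - isc * rsc t * (isc * rsc t)); last by ncring.
  by rewrite ct tt /m; ncring.
have lm : lbd (t ^+ 2) m.
  by have := lbd_shift (t ^+ 2) (sq_lbd ks); rewrite add0r.
have [um nm] := lbd_unit (exprn_gt0 2 t0) lm.
have [uN _] : N \is a GRing.unit /\ N^-1 = N' * m^-1.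
  apply: unit_inverse; first by rewrite mulrA NN' mulrV.
  have cN : GRing.comm N m^-1.
    by apply: commrV; rewrite /GRing.comm -{1}N'N -NN'; ncring.
  by rewrite -mulrA -cN mulrA N'N mulrV.
have nN : nrm N^-1 <= t^-1.
  have ti : 0 <= t^-1 by rewrite invr_ge0 ltW.
  rewrite -(ler_pXn2r (ltn0Sn 1)) ?nnegrE ?nrm_ge0//.
  rewrite -nrm_sstar starV// Ns -invrM// ?NN' ?exprVn//.
  by rewrite -Ns star_unit.
pose w := N^-1 * (isc * (rsc t - cIm T)).
have TE : T = N * (1 - w).
  rewrite /w mulrBr mulr1 mulrA mulrV// mul1r mulrBr {1}Tk /N.
  by ncring.
have nw : nrm w <= t^-1 * (t - e).
  apply: le_trans (nrmM _ _) _; rewrite nrm_isc.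
  by apply: ler_pM => //; exact: nrm_ge0.
have [|u ub] := neumann nw; first by rewrite mulrC ltr_pdivrMr//; lra.
split; first by rewrite TE unitrMr.
rewrite TE invrM//; apply: le_trans (nrmM _ _) _.
apply: le_trans (ler_pM (nrm_ge0 _) (nrm_ge0 _) ub nN) _.
rewrite le_eqVlt; apply/orP; left; apply/eqP.
by field; rewrite tn0 /= gt_eqF//=; lra.
Qed.

Lemma inv_cIm_lbd e T : 0 < e -> lbd e (cIm T) ->
  exists2 e', 0 < e' & lbd e' (- cIm T^-1).
Proof.
move=> e0 hT; have [uT _] := cIm_lbd_unit e0 hT.
have [uh _] := lbd_unit e0 hT.
rewrite cIm_inv// opprK; apply: lbd_of_unit.
  by apply: lbd_conj; exact: lbd_le (ltW e0) hT.
by rewrite unitrMr ?unitrV// unitrMr// star_unit// unitrV.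
Qed.

(** Im (T^-1) >= p means - Im T >= T^* p T, and T |-> T^* p T is operator
    convex: for T = (1 - s) P^-1 + s Q^-1, the convex combination of its values
    at P^-1 and Q^-1 exceeds its value at T by
    s (1 - s) (P^-1 - Q^-1)^* p (P^-1 - Q^-1).  The bound M is uniform in s
    since - Im (P^-1) and - Im (Q^-1) are both bounded below by a positive
    number. *)
Lemma disc_convex p P Q e : 0 < e -> lbd e p ->
  lbd 0 (cIm P - p) -> lbd 0 (cIm Q - p) ->
  exists M, forall s, 0 <= s <= 1 ->
    let T := rsc (1 - s) * P^-1 + rsc s * Q^-1 in
    [/\ T \is a GRing.unit, nrm T^-1 <= M & lbd 0 (cIm T^-1 - p)].
Proof.
move=> e0 lp hP hQ.
have lP : lbd e (cIm P) by rewrite -[cIm P](subrK p) -[e]add0r; exact: lbdD.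
have lQ : lbd e (cIm Q) by rewrite -[cIm Q](subrK p) -[e]add0r; exact: lbdD.
have [uP _] := cIm_lbd_unit e0 lP; have [uQ _] := cIm_lbd_unit e0 lQ.
have [e1 e10 l1] := inv_cIm_lbd e0 lP; have [e2 e20 l2] := inv_cIm_lbd e0 lQ.
pose m := Num.min e1 e2.
have m0 : 0 < m by rewrite lt_min e10 e20.
have [m1 m2] : m <= e1 /\ m <= e2 by rewrite !ge_min !lexx orbT.
exists m^-1 => s /andP[s0 s1]; set s' := 1 - s; move=> T.
have s'0 : 0 <= s' by rewrite subr_ge0.
have lT : lbd m (cIm (- T)).
  rewrite /T opprD cImD -!mulrN !cImZr !cImN.
  have := lbdD (lbdZ s'0 l1) (lbdZ s0 l2); apply: lbd_le.
  rewrite /s'; nra.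
have [] := cIm_lbd_unit m0 lT; rewrite unitrN invrN nrmN => uT nT; split => //.
have s'E : rsc s' = 1 - rsc s :> A by rewrite /s' rscB rsc1.
have cs a b : a * (rsc s * b) = rsc s * (a * b) by rewrite mulrA -rscC mulrA.
have -> : cIm T^-1 - p = star T^-1 * (rsc s' * (star P^-1 * (cIm P - p) * P^-1) +
   rsc s * (star Q^-1 * (cIm Q - p) * Q^-1) +
   rsc (s * s') * (star (P^-1 - Q^-1) * p * (P^-1 - Q^-1))) * T^-1.
  have pE : p = star T^-1 * (star T * p * T) * T^-1.
    by rewrite !mulrA starV// mulVr ?star_unit// mul1r mulrK.
  rewrite {1}pE cIm_inv// -mulNr -mulrN -mulrBl -mulrBr; congr (_ * _ * _).
  have -> : - cIm T = rsc s' * (star P^-1 * cIm P * P^-1) +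
                      rsc s * (star Q^-1 * cIm Q * Q^-1).
    by rewrite /T cImD !cImZr !cIm_inv//; ncring.
  have -> : star T = rsc s' * star P^-1 + rsc s * star Q^-1.
    by rewrite starD !starM !star_rsc -!rscC.
  rewrite rscM s'E starB /T s'E.
  set X := P^-1; set Y := Q^-1; set X' := star X; set Y' := star Y.
  have -> : (1 - rsc s) * X + rsc s * Y = X + rsc s * (Y - X) by ncring.
  rewrite [_ * p * (X + _)]mulrDr [_ * p * (rsc s * _)]cs; ncring.
have lp0 : lbd 0 p by apply: lbd_le lp; exact: ltW.
apply: lbd_conj; apply: lbdD0; [apply: lbdD0|].
- by apply: lbdZ0 => //; exact: lbd_conj.
- by apply: lbdZ0 => //; exact: lbd_conj.
- by apply: lbdZ0; [exact: mulr_ge0|exact: lbd_conj].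
Qed.

Lemma HplusP b : Hplus b <-> exists2 e, 0 < e & lbd e (cIm b).
Proof.
split=> [[[c cE] ub]|[e e0 hb]].
  by apply: lbd_of_unit => //; rewrite cE; exact: kelley_vaught.
split; last by have [] := lbd_unit e0 hb.
have [r [rs _ <- _]] := lbd_sqrt (lbd_le (ltW e0) hb).
by exists r; rewrite rs.
Qed.

Lemma cle_lbd a b : cle a b -> lbd 0 (b - a).
Proof. by move=> [c ->]; exact: kelley_vaught. Qed.

Lemma nrm_cIm T : nrm (cIm T) <= nrm T.
Proof.
rewrite /cIm nrmZ normfV normrM normCi mulr1 ger0_norm//.
have -> : (2 : R[i])^-1 = real_complex R 2^-1 by rewrite fmorphV rmorph_nat.
have := nrmB T (star T); rewrite nrm_star /=; lra.
Qed.

End ImaginaryPart.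

(** * Completely positive maps are bounded *)

Section PositiveMap.
Context {R : realType} {A B : cstarAlgType R}.

Lemma linear_rsc (f : {linear A -> B}) (t : R) (a : A) :
  f (rsc t * a) = rsc t * f a.
Proof. by rewrite !mul_rscl linearZ. Qed.

Lemma linear_isc (f : {linear A -> B}) (a : A) : f (isc * a) = isc * f a.
Proof. by rewrite !mulr_algl linearZ. Qed.

(** A nonnegative h is r^* r with r = sqrt h; as a 1 x 1 matrix it is sent to an
    element of the same form, which is nonnegative by [kelley_vaught]. *)
Lemma completely_positive_lbd (f : {linear A -> B}) (h : A) :
  completely_positive f -> lbd 0 h -> lbd 0 (f h).
Proof.
move=> cp /lbd_sqrt[r [rs _ <- _]].
pose Y : 'M[A]_1 := const_mx r.
have [|Z /matrixP/(_ 0 0)] := cp 1%N (mxstar Y *m Y); first by exists Y.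
rewrite !mxE !big_ord1 !mxE rs => ->; exact: kelley_vaught.
Qed.

(** For selfadjoint h the elements |h| - h and |h| + h are nonnegative, and so
    are their images |h| - f h and |h| + f h, whose sum is 2 |h|; the general
    case follows by splitting into real and imaginary parts. *)
Lemma completely_positive_bounded (f : {linear A -> B}) :
  completely_positive f -> f 1 = 1 -> forall a, nrm (f a) <= 6 * nrm a.
Proof.
move=> cp f1.
have sab h : star h = h -> nrm (f h) <= 3 * nrm h.
  move=> hs; have h0 := nrm_ge0 h.
  have frsc : f (rsc (nrm h)) = rsc (nrm h).
    by rewrite -[rsc _]mulr1 linear_rsc f1 mulr1.
  have l1 := completely_positive_lbd cp (nrm_lbd hs (lexx _)).
  have l2 : lbd 0 (f (rsc (nrm h) + h)).
    apply: completely_positive_lbd => //.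
    by rewrite -[h in X in lbd _ X]opprK; apply: nrm_lbd; rewrite ?nrmN ?starN ?hs.
  rewrite linearB frsc in l1; rewrite linearD frsc in l2.
  have := @lbd_nrm_le _ _ (rsc (nrm h) - f h) (nrm h + nrm h).
  have -> : rsc (nrm h + nrm h) - (rsc (nrm h) - f h) = rsc (nrm h) + f h.
    by rewrite rscD; ncring.
  move=> /(_ (addr_ge0 h0 h0) l1 l2) l3.
  have := nrmB (rsc (nrm h)) (rsc (nrm h) - f h); rewrite subKr nrm_rsc ger0_norm//.
  lra.
move=> a; rewrite {1}(cartesian a) linearD linear_rsc linear_isc.
apply: le_trans (nrmD _ _) _; rewrite nrm_isc nrm_rscM ger0_norm ?invr_ge0//.
have h1 : star (a + star a) = a + star a by rewrite starD starK addrC.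
have := sab _ h1; have := sab _ (star_cIm a); have := nrm_cIm a.
have := nrmD a (star a); rewrite nrm_star; lra.
Qed.

End PositiveMap.
(** * Derivatives of Cauchy transforms *)

Section Differential.
Context {R : realType} {A B : cstarAlgType R}.

Lemma near_nrm (b : B) (P : B -> Prop) (r : R) : 0 < r ->
  (forall z, nrm (z - b) < r -> P z) -> \forall z \near b, P z.
Proof.
move=> r0 h; apply/nbhs_ballP; exists (real_complex R r); first by rewrite /= ltcR.
by move=> z; rewrite -ball_normE /= normE ltcR nrmC => /h.
Qed.

Lemma near_Hplus (b : B) : Hplus b -> \forall z \near b, Hplus z.
Proof.
move=> /HplusP[e e0 [_ [t ht]]].
apply: (@near_nrm _ _ (e / 2)); first by rewrite divr_gt0.
move=> z zb; apply/HplusP; exists (e / 2); first by rewrite divr_gt0.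
split; first exact: star_cIm.
exists t; apply: le_trans (nrm_triangle _ (cIm b) _) _.
have := nrm_cIm (z - b); rewrite cImB nrmC; lra.
Qed.

(** Differentials only depend on germs; this transports the chain rule from
    G_x o w1 to G_(x+y), which agree on the open upper half-plane only. *)
Lemma near_eq_diff (f g : B -> B) (b : B) :
  (\forall z \near b, f z = g z) -> differentiable f b ->
  'd g b = 'd f b :> (B -> B).
Proof.
move=> fg df; apply: diff_unique; first exact: diff_continuous.
have /eqaddoP fo := diff_locally df.
have fgb : \forall h \near (0 : B), f (h + b) = g (h + b).
  by move: fg; rewrite (near_shift 0 b) subr0.
apply/eqaddoP => e e0; near=> h.
have fgh : f (h + b) = g (h + b) by near: h; exact: fgb.
have -> : (g \o shift b - (cst (g b) + 'd f b)) h = (f \o shift b - (cst (f b) + 'd f b)) h.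
  by rewrite !fctE /= /shift/= fgh (nbhs_singleton fg).
by near: h; exact: fo.
Unshelve. all: by end_near. Qed.

Variables (iota : {lrmorphism B -> A}) (E : {linear A -> B}).
Hypothesis iotaN : forall b, nrm (iota b) = nrm b.
Hypothesis EN : forall a, nrm (E a) <= 6 * nrm a.

Definition dGtr (x : A) (b h : B) : B :=
  - E ((iota b - x)^-1 * iota h * (iota b - x)^-1).

Lemma dGtr_is_linear x b : linear (dGtr x b).
Proof.
move=> k u v; rewrite /dGtr linearP mulrDr mulrDl -scalerAr -scalerAl linearP.
by rewrite opprD scalerN.
Qed.
HB.instance Definition _ x b :=
  GRing.isLinear.Build R[i] B B *:%R (dGtr x b) (@dGtr_is_linear x b).

(** The remainder is exactly (T + H)^-1 H T^-1 H T^-1. *)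
Lemma resolvent_expansion (T H : A) : T \is a GRing.unit ->
  nrm T^-1 * nrm H <= 2^-1 ->
  nrm ((T + H)^-1 - T^-1 + T^-1 * H * T^-1) <= 2 * nrm T^-1 ^+ 3 * nrm H ^+ 2.
Proof.
move=> uT hH; have K0 := nrm_ge0 T^-1; have H0 := nrm_ge0 H.
have hw : nrm (- (T^-1 * H)) <= 2^-1 by rewrite nrmN; apply: le_trans (nrmM _ _) hH.
have [|u ub] := neumann hw; first by lra.
rewrite opprK in u ub.
have TH : T + H = T * (1 + T^-1 * H) by rewrite mulrDr mulr1 mulrA mulrV// mul1r.
have uTH : T + H \is a GRing.unit by rewrite TH unitrMr.
have nTH : nrm (T + H)^-1 <= 2 * nrm T^-1.
  rewrite TH invrM//; apply: le_trans (nrmM _ _) _; apply: ler_wpM2r => //.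
  by apply: le_trans ub _; rewrite le_eqVlt; apply/orP; left; apply/eqP; field.
have -> : (T + H)^-1 - T^-1 + T^-1 * H * T^-1 = (T + H)^-1 * H * T^-1 * H * T^-1.
  have e1 : (T + H)^-1 - T^-1 = - ((T + H)^-1 * H * T^-1).
    have e : (T + H)^-1 * (T + H) * T^-1 = T^-1 by rewrite mulVr// mul1r.
    rewrite -[T^-1 in LHS]e mulrDr mulrDl.
    by rewrite -[_ * T * _]mulrA mulrV// mulr1; ncring.
  have YE : T^-1 = (T + H)^-1 + (T + H)^-1 * H * T^-1.
    by rewrite -[T^-1 in LHS](subKr (T + H)^-1) e1 opprK.
  rewrite e1; have -> : T^-1 * H * T^-1 = ((T + H)^-1 + (T + H)^-1 * H * T^-1) * H * T^-1.
    by rewrite -YE.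
  ncring.
set Z := (T + H)^-1 in nTH *; have Z0 := nrm_ge0 Z.
have h1 : nrm (Z * H * T^-1 * H * T^-1) <= nrm Z * nrm H * nrm T^-1 * nrm H * nrm T^-1.
  do 4![apply: le_trans (nrmM _ _) _; apply: ler_wpM2r => //].
apply: le_trans h1 _.
have -> : 2 * nrm T^-1 ^+ 3 * nrm H ^+ 2 =
  2 * nrm T^-1 * (nrm H * nrm T^-1 * nrm H * nrm T^-1) by ring.
rewrite -!mulrA [leRHS]mulrA; apply: ler_wpM2r => //.
by rewrite !mulr_ge0.
Qed.

Lemma continuous_dGtr x b : continuous (dGtr x b).
Proof.
apply/linear_bounded_continuous/linear_boundedP.
pose K := 6 * nrm (iota b - x)^-1 ^+ 2.
have K0 : 0 <= K by rewrite mulr_ge0// exprn_ge0// nrm_ge0.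
exists (real_complex R K); split; first by rewrite complex_real.
move=> r Kr h; apply: le_trans (_ : real_complex R K * `|h| <= _); last first.
  by apply: ler_wpM2r => //; exact: ltW.
rewrite !normE -rcM lecR /dGtr nrmN; apply: le_trans (EN _) _.
have -> : K * nrm h = 6 * (nrm (iota b - x)^-1 * nrm (iota h) * nrm (iota b - x)^-1).
  by rewrite iotaN /K; ring.
rewrite ler_pM2l//; apply: le_trans (nrmM _ _) _.
by apply: ler_wpM2r; [exact: nrm_ge0|exact: nrmM].
Qed.

Lemma dGtr_littleo x b : iota b - x \is a GRing.unit ->
  Gtr iota E x \o shift b = cst (Gtr iota E x b) + dGtr x b +o_ (0 : B) id.
Proof.
move=> uT; set T := iota b - x in uT; apply/eqaddoP => e e0.
have [r r0 ->] := complex_gt0P e0.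
pose K := nrm T^-1; have K0 : 0 <= K := nrm_ge0 _.
(* The first bound makes the expansion of the resolvent applicable; the second
   turns its remainder 2 K^3 |h|^2, amplified by the factor 6 of E, into
   r |h|. *)
pose d := Num.min (2 * K + 1)^-1 (r / (12 * K ^+ 3 + 1)).
have K3 : 0 <= K ^+ 3 by rewrite exprn_ge0.
have d0 : 0 < d by rewrite lt_min invr_gt0 divr_gt0 ?andbT//; lra.
apply: (near_nrm d0) => h; rewrite subr0 lt_min => /andP[h1 h2].
have h0 := nrm_ge0 h.
rewrite !normE /= -rcM lecR.
have -> : (Gtr iota E x \o shift b - (cst (Gtr iota E x b) + dGtr x b)) h =
  E ((T + iota h)^-1 - T^-1 + T^-1 * iota h * T^-1).
  have iE : iota (h + b) - x = T + iota h by rewrite linearD /T; ncring.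
  rewrite !fctE /= /Gtr /dGtr -/T /shift/= iE.
  by rewrite (linearD E) (linearB E); ncring.
apply: le_trans (EN _) _.
have hs : nrm T^-1 * nrm (iota h) <= 2^-1.
  rewrite iotaN -/K; move: h1; rewrite -[ltRHS]mul1r ltr_pdivlMr; last by lra.
  by nra.
apply: le_trans (ler_wpM2l _ (resolvent_expansion uT hs)) _ => //.
rewrite iotaN -/K; move: h2; rewrite ltr_pdivlMr; last by lra.
rewrite expr2; nra.
Qed.

Lemma diff_Gtr x b : iota b - x \is a GRing.unit ->
  'd (Gtr iota E x) b = dGtr x b :> (B -> B).
Proof.
move=> uT; apply: diff_unique; [exact: continuous_dGtr|exact: dGtr_littleo].
Qed.

Lemma differentiable_Gtr x b : iota b - x \is a GRing.unit ->
  differentiable (Gtr iota E x) b.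
Proof.
move=> uT; apply/diff_locallyP; rewrite diff_Gtr//.
by split; [exact: continuous_dGtr|exact: dGtr_littleo].
Qed.

End Differential.
(** * Dual numbers *)

Definition dual (A : Type) : Type := (A * A)%type.

Section DualRing.
Context {K : comNzRingType} {A : algType K}.

HB.instance Definition _ := GRing.Lmodule.copy (dual A) (A * A)%type.

Definition dual_one : dual A := (1, 0).
Definition dual_mul (p q : dual A) : dual A :=
  (p.1 * q.1, p.1 * q.2 + p.2 * q.1).

Fact dual_mulA : associative dual_mul.
Proof.
move=> p q r; rewrite /dual_mul /=; congr (_, _); first exact: mulrA.
by rewrite !mulrDr !mulrDl !mulrA addrA.
Qed.

Fact dual_mul1 : left_id dual_one dual_mul.
Proof. by move=> [p q]; rewrite /dual_mul /= !mul1r mul0r addr0. Qed.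

Fact dual_1mul : right_id dual_one dual_mul.
Proof. by move=> [p q]; rewrite /dual_mul /= !mulr1 mulr0 add0r. Qed.

Fact dual_mulDl : left_distributive dual_mul +%R.
Proof.
move=> p q r; rewrite /dual_mul; congr (_, _) => /=; first exact: mulrDl.
by rewrite !mulrDl addrACA.
Qed.

Fact dual_mulDr : right_distributive dual_mul +%R.
Proof.
move=> p q r; rewrite /dual_mul; congr (_, _) => /=; first exact: mulrDr.
by rewrite !mulrDr addrACA.
Qed.

Fact dual_one_neq0 : dual_one != 0.
Proof. by apply/eqP => -[/eqP]; rewrite oner_eq0. Qed.

HB.instance Definition _ := GRing.Zmodule_isNzRing.Build (dual A)
  dual_mulA dual_mul1 dual_1mul dual_mulDl dual_mulDr dual_one_neq0.

Fact dual_scaleAl (k : K) (p q : dual A) : k *: (p * q) = (k *: p : dual A) * q.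
Proof.
apply/pair_eqP/andP; split; apply/eqP => /=; first by rewrite scalerAl.
by rewrite scalerDr !scalerAl.
Qed.

HB.instance Definition _ := GRing.Lmodule_isLalgebra.Build K (dual A) dual_scaleAl.

Fact dual_scaleAr (k : K) (p q : dual A) : k *: (p * q) = p * (k *: q : dual A).
Proof.
apply/pair_eqP/andP; split; apply/eqP => /=; first by rewrite scalerAr.
by rewrite scalerDr !scalerAr.
Qed.

HB.instance Definition _ := GRing.Lalgebra_isAlgebra.Build K (dual A) dual_scaleAr.

Implicit Types p q : dual A.
Lemma dual_mul1E p q : (p * q).1 = p.1 * q.1. Proof. by []. Qed.
Lemma dual_mul2E p q : (p * q).2 = p.1 * q.2 + p.2 * q.1. Proof. by []. Qed.
Lemma dual_add1E p q : (p + q).1 = p.1 + q.1. Proof. by []. Qed.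
Lemma dual_add2E p q : (p + q).2 = p.2 + q.2. Proof. by []. Qed.
Lemma dual_opp1E p : (- p).1 = - p.1. Proof. by []. Qed.
Lemma dual_opp2E p : (- p).2 = - p.2. Proof. by []. Qed.
Lemma dual_11E : (1 : dual A).1 = 1. Proof. by []. Qed.
Lemma dual_12E : (1 : dual A).2 = 0. Proof. by []. Qed.
Lemma dual_scale1E (k : K) p : (k *: p).1 = k *: p.1. Proof. by []. Qed.
Lemma dual_scale2E (k : K) p : (k *: p).2 = k *: p.2. Proof. by []. Qed.
Definition dualE := (dual_scale1E, dual_scale2E, dual_mul1E, dual_mul2E,
  dual_add1E, dual_add2E, dual_opp1E,
  dual_opp2E, dual_11E, dual_12E).

Lemma dual_prod1 n (P : nat -> dual A) :
  (\prod_(0 <= k < n) P k).1 = \prod_(0 <= k < n) (P k).1.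
Proof.
elim: n => [|n ih]; first by rewrite !big_nil.
by rewrite !big_nat_recr//= ih.
Qed.

Lemma dual_prod2 n (P : nat -> dual A) :
  (\prod_(0 <= k < n) P k).2 = \sum_(0 <= j < n)
    (\prod_(0 <= k < j) (P k).1) * (P j).2 * \prod_(j.+1 <= k < n) (P k).1.
Proof.
elim: n => [|n ih]; first by rewrite !big_nil.
rewrite big_nat_recr//= [RHS]big_nat_recr//= dual_prod1 ih addrC; congr (_ + _).
  by rewrite [X in _ * _ * X]big_geq// mulr1.
rewrite mulr_suml; apply: eq_big_nat => j /andP[_ jn].
by rewrite [\prod_(j.+1 <= k < n.+1) _]big_nat_recr//= !mulrA.
Qed.

End DualRing.

(** Exposes one factor of a word, so that a word can be studied as a function
    of a single letter. *)
Lemma prod_slot (T : nzRingType) n j (a : nat -> T) u : (j < n)%N ->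
  \prod_(0 <= k < n) (if k == j then u else a k) =
  (\prod_(0 <= k < j) a k) * u * \prod_(j.+1 <= k < n) a k.
Proof.
move=> jn; rewrite (@big_cat_nat _ _ _ j) ?(ltnW jn)//= [X in _ * X]big_ltn// eqxx mulrA.
congr (_ * _ * _); apply: eq_big_nat => k /andP[k1 k2].
  by rewrite ltn_eqF.
by rewrite gtn_eqF.
Qed.

(** * Resolvents as limits of polynomials *)

Section Continuation.
Context {R : realType} {D : algType R[i]}.
Variables (N : D -> R) (L : D -> Prop).
Hypothesis N_ge0 : forall p, 0 <= N p.
Hypothesis NM : forall p q, N (p * q) <= N p * N q.
Hypothesis NZ : forall t p, N (real_complex R t *: p) = `|t| * N p.
Hypothesis L0 : L 0.
Hypothesis LD : forall p q, L p -> L q -> L (p + q).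
Hypothesis LZ : forall t p, L p -> L (real_complex R t *: p).
Hypothesis Lcl : forall p,
  (forall e, 0 < e -> exists2 q, L q & N (p - q) <= e) -> L p.
Variable a : D.
Hypothesis La : forall p, L p -> L (a * p).

Let line (z : R) := 1 - real_complex R z *: a.

(** Writing line z' = line z (1 - w) with w = (z' - z) r a of norm at most 1/2,
    the vector r' p is the limit of the partial sums of w^j (r p), all of which
    lie in L. *)
Lemma neumann_step (z z' : R) (r r' : D) (M : R) : N r <= M -> `|z' - z| * (M * N a) <= 2^-1 ->
  r * line z = 1 -> line z * r = 1 -> line z' * r' = 1 ->
  (forall p, L p -> L (r * p)) -> forall p, L p -> L (r' * p).
Proof.
move=> rM zz rl lr lr' Lr p Lp.
pose w := real_complex R (z' - z) *: (r * a).
have Lw q : L q -> L (w * q).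
  by move=> Lq; rewrite /w -scalerAl -mulrA; apply/LZ/Lr/La.
have Nw : N w <= 2^-1.
  apply: le_trans zz; rewrite /w NZ ler_wpM2l//; apply: le_trans (NM _ _) _.
  by rewrite ler_wpM2r.
pose v := r' * p; pose q := r * p.
have vE : v = q + w * v.
  have lw : line z' = line z * (1 - w).
    rewrite mulrBr mulr1 /w -scalerAr mulrA lr mul1r /line rcB scalerBl.
    by ncring.
  have e : (1 - w) * v = q.
    have -> : 1 - w = r * line z' by rewrite lw mulrA rl mul1r.
    by rewrite /v -mulrA [line z' * _]mulrA lr' mul1r.
  by rewrite -e mulrBl mul1r subrK.
pose s := fix s n := if n is m.+1 then q + w * s m else 0.
have Ls n : L (s n).
  by elim: n => [|n ih] //=; apply: LD; [exact: Lr|exact: Lw].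
have Ns n : N (v - s n) <= 2^-1 ^+ n * N v.
  elim: n => [|n ih] /=; first by rewrite subr0 expr0 mul1r.
  rewrite {1}vE (_ : _ - _ = w * (v - s n)); last by ncring.
  apply: le_trans (NM _ _) _; rewrite exprS -mulrA.
  by apply: ler_pM.
apply: Lcl => e e0.
have c0 : 0 < N v + 1 by have := N_ge0 v; lra.
have /cvgrPdist_lt/(_ _ (divr_gt0 e0 c0))[n _ /(_ n (leqnn n))] :
    ((GRing.exp (2^-1 : R) : nat -> R) @ \oo --> (0 : R))%classic.
  by apply: cvg_expr; rewrite ger0_norm; lra.
rewrite /= sub0r normrN ger0_norm ?exprn_ge0 ?invr_ge0// ltr_pdivlMr// => hn.
exists (s n) => //; apply: le_trans (Ns n) _.
have : 0 <= 2^-1 ^+ n :> R by rewrite exprn_ge0.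
lra.
Qed.

(** The resolvent preserves every closed subspace L that a preserves, although
    its power series may diverge: the segment from 1 to 1 - a is covered by
    finitely many steps of length 1 / n, short enough for the Neumann series. *)
Lemma resolvent_continuation M :
  (forall z, 0 <= z <= 1 ->
     exists r, [/\ r * line z = 1, line z * r = 1 & N r <= M]) ->
  forall r, (1 - a) * r = 1 -> forall p, L p -> L (r * p).
Proof.
move=> inv r ar.
have M0 : 0 <= M.
  by have [|s [_ _ sM]] := inv 0; [rewrite lexx ler01|apply: le_trans sM].
pose C := 2 * (M * N a); have C0 : 0 <= C by rewrite !mulr_ge0.
pose n := (Num.bound C).+1.
have n0 : 0 < n%:R :> R by rewrite ltr0n.
have Cn : C < n%:R.
  by apply: lt_le_trans (archi_boundP C0) _; rewrite ler_nat.
have key j : (j <= n)%N -> forall s, line (j%:R / n%:R) * s = 1 ->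
    s * line (j%:R / n%:R) = 1 -> forall p, L p -> L (s * p).
  elim: j => [_ s|j ih jn s ls sl].
    rewrite /line mul0r rc0 scale0r subr0 mul1r => -> _ p Lp.
    by rewrite mul1r.
  have [|s0 [s0l ls0 s0M]] := inv (j%:R / n%:R).
    rewrite divr_ge0//= ler_pdivrMr// mul1r ler_nat; exact: ltnW.
  apply: (neumann_step s0M _ s0l ls0 ls); last exact: ih (ltnW jn) _ ls0 s0l.
  rewrite -mulrBl -natr1 addrAC subrr add0r mul1r ger0_norm ?invr_ge0//.
  rewrite mulrC ler_pdivrMr//; move: Cn; rewrite /C; lra.
have [|s1 [s1l ls1 _]] := inv 1; first by rewrite lexx ler01.
have l1 : line 1 = 1 - a by rewrite /line rc1 scale1r.
have rs : r = s1.
  by rewrite -[LHS]mul1r -s1l -mulrA l1 ar mulr1.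
have nn : n%:R / n%:R = 1 :> R by rewrite divff// gt_eqF.
by move=> p Lp; apply: (key n (leqnn n)) => //; rewrite nn rs.
Qed.

End Continuation.
(** * Closed subalgebras *)

Section ClosedSubalgebra.
Context {R : realType} {A B : cstarAlgType R}.
Variable (iota : {lrmorphism B -> A}).
Implicit Types (x a c : A) (S : set A).

Lemma alg_gen_subalg x : GRing.subalg_closed (mem (alg_gen iota x)).
Proof.
split=> [|k u v|u v].
- by rewrite inE => M [/= Mcl _]; have [h _ _] := Mcl; move: h; rewrite inE.
- rewrite !inE => ku kv M MM; have [/= Mcl _] := MM; have [_ h _] := Mcl.
  by have := h k u v; rewrite !inE; apply; [exact: ku|exact: kv].
- rewrite !inE => ku kv M MM; have [/= Mcl _] := MM; have [_ _ h] := Mcl.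
  by have := h u v; rewrite !inE; apply; [exact: ku|exact: kv].
Qed.

Lemma alg_gen1 x : alg_gen iota x 1.
Proof. by have [h _ _] := alg_gen_subalg x; move: h; rewrite inE. Qed.

Lemma alg_genP x k u v : alg_gen iota x u -> alg_gen iota x v ->
  alg_gen iota x (k *: u + v).
Proof.
by have [_ h _] := alg_gen_subalg x; have := h k u v; rewrite !inE.
Qed.

Lemma alg_genM x u v : alg_gen iota x u -> alg_gen iota x v ->
  alg_gen iota x (u * v).
Proof. by have [_ _ h] := alg_gen_subalg x; have := h u v; rewrite !inE. Qed.

Lemma alg_gen_iota x b : alg_gen iota x (iota b).
Proof. by move=> M [/= _]; apply; left; exists b. Qed.

Lemma alg_gen_id x : alg_gen iota x x.
Proof. by move=> M [/= _]; apply; right. Qed.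

Lemma alg_gen0 x : alg_gen iota x 0.
Proof. by rewrite -(linear0 iota); exact: alg_gen_iota. Qed.

Lemma alg_genD x u v : alg_gen iota x u -> alg_gen iota x v ->
  alg_gen iota x (u + v).
Proof. by move=> hu hv; rewrite -[u]scale1r; exact: alg_genP. Qed.

Lemma alg_genB x u v : alg_gen iota x u -> alg_gen iota x v ->
  alg_gen iota x (u - v).
Proof.
by move=> hu hv; rewrite addrC -[- v]scaleN1r; exact: alg_genP.
Qed.

Definition nclosure S a : Prop :=
  forall e : R, 0 < e -> exists2 a', S a' & nrm (a - a') <= e.

Lemma sub_nclosure S a : S a -> nclosure S a.
Proof. by move=> Sa e e0; exists a => //; rewrite subrr nrm0 ltW. Qed.

Lemma nclosure_idem S a : nclosure (nclosure S) a -> nclosure S a.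
Proof.
move=> h e e0; have e2 : 0 < e / 2 by rewrite divr_gt0.
have [a' ha' d1] := h _ e2; have [a2 Sa2 d2] := ha' _ e2.
by exists a2 => //; apply: le_trans (nrm_triangle _ a' _) _; lra.
Qed.

Lemma nclosure_alg_genD x u v : nclosure (alg_gen iota x) u -> nclosure (alg_gen iota x) v ->
  nclosure (alg_gen iota x) (u + v).
Proof.
move=> hu hv e e0; have e2 : 0 < e / 2 by rewrite divr_gt0.
have [u' Su d1] := hu _ e2; have [v' Sv d2] := hv _ e2.
exists (u' + v'); first exact: alg_genD.
have -> : u + v - (u' + v') = (u - u') + (v - v') by ncring.
by apply: le_trans (nrmD _ _) _; lra.
Qed.

Lemma nclosure_alg_genM x u v : nclosure (alg_gen iota x) u -> nclosure (alg_gen iota x) v ->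
  nclosure (alg_gen iota x) (u * v).
Proof.
move=> hu hv e e0.
have nu := nrm_ge0 u; have nv := nrm_ge0 v.
pose d := Num.min 1 (e / (nrm u + nrm v + 2)).
have d0 : 0 < d by rewrite lt_min ltr01 divr_gt0//; lra.
have [d1 d2] : d <= 1 /\ d <= e / (nrm u + nrm v + 2).
  by rewrite !ge_min !lexx orbT.
have [u' Su du] := hu _ d0; have [v' Sv dv] := hv _ d0.
exists (u' * v'); first exact: alg_genM.
have -> : u * v - u' * v' = (u - u') * v + u * (v - v') - (u - u') * (v - v').
  by ncring.
apply: le_trans (nrmB _ _) _; apply: le_trans (lerD (nrmD _ _) (lexx _)) _.
have := nrmM (u - u') v; have := nrmM u (v - v'); have := nrmM (u - u') (v - v').
have := nrm_ge0 (u - u'); have := nrm_ge0 (v - v').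
move: d2; rewrite ler_pdivlMr; last by lra.
nra.
Qed.

Lemma nclosure_alg_genZ x k u : nclosure (alg_gen iota x) u -> nclosure (alg_gen iota x) (k *: u).
Proof.
move=> hu; rewrite -mulr_algl; apply: nclosure_alg_genM => //; apply: sub_nclosure.
by rewrite -[k%:A]addr0; apply: alg_genP; [exact: alg_gen1|exact: alg_gen0].
Qed.

Lemma nclosure_alg_genN x u : nclosure (alg_gen iota x) u -> nclosure (alg_gen iota x) (- u).
Proof. by rewrite -scaleN1r; exact: nclosure_alg_genZ. Qed.

Lemma nclosure_iota x b : nclosure (alg_gen iota x) (iota b).
Proof. by apply: sub_nclosure; exact: alg_gen_iota. Qed.

Hypothesis iota_nrm : forall b, nrm (iota b) = nrm b.
Hypothesis iotastar : forall b, iota (star b) = star (iota b).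

Lemma iota_rsc t : iota (rsc t) = rsc t.
Proof. by rewrite /rsc linearZ rmorph1. Qed.

Lemma iota_cIm b : iota (cIm b) = cIm (iota b).
Proof. by rewrite /cIm linearZ linearB /= iotastar. Qed.

Lemma lbd_iota e b : lbd e b -> lbd e (iota b).
Proof.
move=> [bs [t ht]]; split; first by rewrite -iotastar bs.
by exists t; rewrite -iota_rsc -linearB iota_nrm.
Qed.

Lemma cIm_iotaB b x : star x = x -> cIm (iota b - x) = iota (cIm b).
Proof. by move=> xs; rewrite cImB (cIm_sa xs) subr0 iota_cIm. Qed.

Lemma iota_unitV b : b \is a GRing.unit ->
  iota b \is a GRing.unit /\ (iota b)^-1 = iota b^-1.
Proof. by move=> ub; apply: unit_inverse; rewrite -rmorphM ?mulrV ?mulVr// rmorph1. Qed.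

Lemma resolvent_unit b x : Hplus b -> star x = x -> iota b - x \is a GRing.unit.
Proof.
move=> /HplusP[e e0 he] xs.
by have [] := @cIm_lbd_unit _ _ e (iota b - x) e0; rewrite ?cIm_iotaB//; exact: lbd_iota.
Qed.

(** The operators b - z x, for z in [0, 1], all have the same imaginary part
    Im b, hence uniformly bounded inverses, and (b - x)^-1 is reached by
    continuation from b^-1. *)
Lemma resolvent_nclosure b x : Hplus b -> star x = x ->
  nclosure (alg_gen iota x) (iota b - x)^-1.
Proof.
move=> hb xs; have /HplusP[e e0 he] := hb.
have [ub _] := cIm_lbd_unit e0 he; have [uib ibV] := iota_unitV ub.
have uT := resolvent_unit hb xs.
have TE : iota b - x = iota b * (1 - iota b^-1 * x).
  by rewrite mulrBr mulr1 -ibV mulVKr.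
have uT' : 1 - iota b^-1 * x \is a GRing.unit by move: uT; rewrite TE unitrMr.
rewrite TE invrM// ibV.
apply: (@resolvent_continuation R A (@nrm R A) (nclosure (alg_gen iota x)) _ _ _ _ _ _ _
   (iota b^-1 * x) _ (e^-1 * nrm (iota b))).
- exact: nrm_ge0.
- exact: nrmM.
- exact: nrmZr.
- by apply: sub_nclosure; exact: alg_gen0.
- exact: nclosure_alg_genD.
- by move=> t p; exact: nclosure_alg_genZ.
- by move=> p; exact: nclosure_idem.
- move=> p hp; apply: nclosure_alg_genM => //; apply: nclosure_alg_genM; first exact: nclosure_iota.
  by apply: sub_nclosure; exact: alg_gen_id.
- move=> z _; pose Tz := iota b - real_complex R z *: x.
  have Tzs : star (real_complex R z *: x) = real_complex R z *: x.
    by rewrite starZr xs.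
  have [uTz nTz] : Tz \is a GRing.unit /\ nrm Tz^-1 <= e^-1.
    by apply: cIm_lbd_unit => //; rewrite cIm_iotaB//; exact: lbd_iota.
  have lE : 1 - real_complex R z *: (iota b^-1 * x) = iota b^-1 * Tz.
    by rewrite mulrBr -ibV mulVr// scalerAr.
  exists (Tz^-1 * iota b); rewrite lE; split.
  + by rewrite -mulrA -ibV mulVKr// mulVr.
  + by rewrite -mulrA mulVKr// -ibV mulVr.
  + apply: le_trans (nrmM _ _) _; apply: ler_wpM2r => //; exact: nrm_ge0.
- by rewrite mulrV.
- exact: nclosure_iota.
Qed.

End ClosedSubalgebra.

(** * The norm of dual numbers *)

Section DualNorm.
Context {R : realType} {A : cstarAlgType R}.
Implicit Types P Q : dual A.

Definition dnrm P : R := nrm P.1 + nrm P.2.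

Lemma dnrm_ge0 P : 0 <= dnrm P. Proof. by rewrite addr_ge0// nrm_ge0. Qed.
Lemma dnrmM P Q : dnrm (P * Q) <= dnrm P * dnrm Q.
Proof.
rewrite /dnrm !dualE.
have := nrmM P.1 Q.1; have := nrmM P.1 Q.2; have := nrmM P.2 Q.1.
have := nrmD (P.1 * Q.2) (P.2 * Q.1).
have := nrm_ge0 P.2; have := nrm_ge0 Q.2; nra.
Qed.
Lemma dnrmZ t P : dnrm (real_complex R t *: P) = `|t| * dnrm P.
Proof. by rewrite /dnrm !nrmZr mulrDr. Qed.

Lemma dual_inv (T : dual A) : T.1 \is a GRing.unit ->
  exists r : dual A, [/\ r * T = 1, T * r = 1, r.1 = T.1^-1 &
     r.2 = - (T.1^-1 * T.2 * T.1^-1)].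
Proof.
move=> uT; exists (T.1^-1, - (T.1^-1 * T.2 * T.1^-1)); split=> //;
  apply/pair_eqP/andP; split; apply/eqP => /=; rewrite ?mulVr ?mulrV//.
  by rewrite mulNr mulrVK// subrr.
by rewrite mulrN !mulrA mulrV// mul1r addNr.
Qed.

End DualNorm.
(** * Alternating words *)

Section Words.
Context {R : realType} {A B : cstarAlgType R}.
Variables (iota : {lrmorphism B -> A}) (E E' : {linear A -> B}) (M : R).
Hypothesis hOVI : COVI_space iota E E'.
Hypothesis M_ge0 : 0 <= M.
Hypothesis EN : forall a, nrm (E a) <= M * nrm a.
Hypothesis E'N : forall a, nrm (E' a) <= M * nrm a.
Variables x y : A.
Hypothesis hfree : inf_free iota E E' x y.
Implicit Types (P Q Z l r : dual A) (c : bool).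

(** The vanishing of Phi is the relation that has to be propagated from u and v
    to the resolvent of x + y. *)
Definition Phi P : B := E' P.1 - E P.2.

Lemma iota_nrm b : nrm (iota b) = nrm b.
Proof. by apply: complexI; rewrite -!normE (iota_norm hOVI). Qed.

Lemma PhiD P Q : Phi (P + Q) = Phi P + Phi Q.
Proof. by rewrite /Phi !dualE (linearD E') (linearD E); ncring. Qed.

Lemma PhiB P Q : Phi (P - Q) = Phi P - Phi Q.
Proof. by rewrite /Phi !dualE (linearB E') (linearB E); ncring. Qed.

Lemma PhiZ (k : R[i]) P : Phi (k *: P) = k *: Phi P.
Proof. by rewrite /Phi scalerBr; congr (_ - _); exact: linearZ_LR. Qed.

Lemma Phi1 : Phi 1 = 0.
Proof. by rewrite /Phi !dualE (E'_1 hOVI) linear0 subrr. Qed.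

Lemma nrm_Phi P : nrm (Phi P) <= M * dnrm P.
Proof.
rewrite /Phi /dnrm mulrDr; apply: le_trans (nrmB _ _) _.
by apply: lerD; [exact: E'N|exact: EN].
Qed.

Let S c : set A := if c then alg_gen iota x else alg_gen iota y.

(** The admissible letters.  For a centered element a, infinitesimal freeness
    replaces a by E' a inside a word; any other element with the same
    expectation gives the same result, since the difference is centered and
    the word stays alternating.  Hence only E P.2 is prescribed. *)
Definition letter0 c P :=
  [/\ S c P.1, S c P.2, E P.1 = 0 & E P.2 = E' P.1].

(** Resolvents only belong to the norm closures of the generated algebras. *)
Definition letter c P :=
  [/\ nclosure (S c) P.1, nclosure (S c) P.2, E P.1 = 0 & E P.2 = E' P.1].

Lemma SB c u v : S c u -> S c v -> S c (u - v).
Proof. by rewrite /S; case: c; exact: alg_genB. Qed.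
Lemma SD c u v : S c u -> S c v -> S c (u + v).
Proof. by rewrite /S; case: c; exact: alg_genD. Qed.
Lemma S_iota c b : S c (iota b).
Proof. by rewrite /S; case: c; exact: alg_gen_iota. Qed.

Lemma free_words (n : nat) c (a : nat -> A) : (0 < n)%N ->
  (forall j, (j < n)%N -> S (c (+) odd j) (a j) /\ E (a j) = 0) ->
  E (\prod_(0 <= j < n) a j) = 0 /\
  E' (\prod_(0 <= j < n) a j) = \sum_(0 <= j < n)
    E (\prod_(0 <= k < n) (if k == j then iota (E' (a j)) else a k)).
Proof.
move=> n0 ha.
have [] := hfree (i := fun j : 'I_n => c (+) odd j) (a := fun j : 'I_n => a j) n0.
- by move=> j k kj; rewrite kj /=; case: c {ha} (odd j) => [] [].
- by move=> j; have [] := ha j (ltn_ord j).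
- by move=> j; have [] := ha j (ltn_ord j).
move=> h1 h2; rewrite !big_mkord; split=> //.
by rewrite h2; apply: eq_bigr => j _; congr (E _); rewrite big_mkord.
Qed.

(** The eps-part of a product of dual numbers is the sum over all positions of
    the word in which one letter is replaced by its eps-part, which is the
    shape of the formula defining infinitesimal freeness. *)
Lemma Phi_words0 n c (P : nat -> dual A) :
  (forall j, (j < n)%N -> letter0 (c (+) odd j) (P j)) ->
  Phi (\prod_(0 <= j < n) P j) = 0.
Proof.
case: (posnP n) => [-> _|n0 hP]; first by rewrite big_nil Phi1.
have [|_ e1] := @free_words n c (fun j => (P j).1) n0.
  by move=> j jn; have [] := hP j jn.
rewrite /Phi dual_prod1 e1 dual_prod2 (linear_sum E) -sumrB.
rewrite big_nat big1// => j /andP[_ jn].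
have [Sj1 Sj2 Ej1 Ej2] := hP j jn.
pose beta := (P j).2 - iota (E' (P j).1).
have [|e2 _] := @free_words n c (fun k => if k == j then beta else (P k).1) n0.
  move=> k kn; case: eqP => [->|_]; last by have [] := hP k kn.
  split; first by apply: SB => //; exact: S_iota.
  by rewrite /beta (linearB E) Ej2 (E_id hOVI) subrr.
move: e2; rewrite !prod_slot// /beta mulrBr mulrBl (linearB E) => /subr0_eq ->.
by rewrite subrr.
Qed.

(** Both components are approximated in the generated algebra and then shifted
    by elements of B, so that the two equations on the expectations hold
    exactly. *)
Lemma letter_approx c P : letter c P ->
  forall e, 0 < e -> exists2 Q, letter0 c Q & dnrm (P - Q) <= e.
Proof.
move=> [n1 n2 E1 E2] e e0.
pose C := 1 + M; have C1 : 1 <= C by rewrite lerDl.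
(* An error d in each component grows to at most d (2 C + M C) <= 4 d C^2 after
   recentering. *)
pose d := e / (4 * C ^+ 2).
have C20 : 0 < 4 * C ^+ 2 by rewrite mulr_gt0// exprn_gt0//; lra.
have d0 : 0 < d by rewrite divr_gt0.
have dE : e = d * (4 * C ^+ 2) by rewrite divfK// gt_eqF.
clearbody d.
have [a Sa da] := n1 _ d0; have [b Sb db] := n2 _ d0.
pose a' := a - iota (E a).
have da' : nrm (P.1 - a') <= d * C.
  have -> : P.1 - a' = (P.1 - a) - iota (E (P.1 - a)).
    by rewrite (linearB E) E1 sub0r linearN /a'; ncring.
  apply: le_trans (nrmB _ _) _; rewrite iota_nrm.
  by have := EN (P.1 - a); have := ler_wpM2l M_ge0 da; rewrite /C; lra.
exists (a', b - iota (E b) + iota (E' a')).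
  split=> /=.
  - by apply: SB => //; exact: S_iota.
  - by apply: SD; [apply: SB => //|]; exact: S_iota.
  - by rewrite /a' (linearB E) (E_id hOVI) subrr.
  - by rewrite (linearD E) (linearB E) !(E_id hOVI) subrr add0r.
rewrite /dnrm !dualE /=.
have -> : P.2 - (b - iota (E b) + iota (E' a')) =
    (P.2 - b) - iota (E (P.2 - b)) + iota (E' (P.1 - a')).
  by rewrite (linearB E) (linearB E') E2 !linearB; ncring.
have h1 : nrm (P.2 - b - iota (E (P.2 - b)) + iota (E' (P.1 - a'))) <=
    d + M * d + M * (d * C).
  apply: le_trans (nrmD _ _) _; apply: lerD; last first.
    by rewrite iota_nrm; apply: le_trans (E'N _) _; rewrite ler_wpM2l.
  apply: le_trans (nrmB _ _) _; apply: lerD => //.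
  by rewrite iota_nrm; apply: le_trans (EN _) _; rewrite ler_wpM2l.
apply: le_trans (lerD da' h1) _; rewrite dE.
have -> : d * C + (d + M * d + M * (d * C)) = d * (2 * C + M * C) by rewrite /C; ring.
have m0 := M_ge0.
by rewrite ler_pM2l// /C; nra.
Qed.

Lemma Phi_slot_closed l r P :
  (forall e : R, 0 < e -> exists2 Q, Phi (l * Q * r) = 0 & dnrm (P - Q) <= e) ->
  Phi (l * P * r) = 0.
Proof.
move=> hP; apply/nrm_le0/ler_addgt0Pr => e e0; rewrite add0r.
pose K := M * (dnrm l * dnrm r) + 1.
have K0 : 0 < K by rewrite ltr_wpDl// !mulr_ge0// dnrm_ge0.
have [Q hQ] := hP _ (divr_gt0 e0 K0); rewrite ler_pdivlMr// => dQ.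
have -> : Phi (l * P * r) = Phi (l * (P - Q) * r).
  by rewrite mulrBr mulrBl PhiB hQ subr0.
apply: le_trans (nrm_Phi _) _.
have h : dnrm (l * (P - Q) * r) <= dnrm l * dnrm (P - Q) * dnrm r.
  apply: le_trans (dnrmM _ _) _; apply: ler_wpM2r; first exact: dnrm_ge0.
  exact: dnrmM.
apply: le_trans (ler_wpM2l M_ge0 h) _.
have g := dnrm_ge0 (P - Q).
have -> : M * (dnrm l * dnrm (P - Q) * dnrm r) =
  dnrm (P - Q) * (M * (dnrm l * dnrm r)) by ring.
by apply: le_trans dQ; apply: ler_wpM2l => //; rewrite /K; lra.
Qed.

(** Letters in the closure are admitted one position at a time: with all other
    letters fixed, Phi is continuous in the letter under consideration. *)
Lemma Phi_words n c (P : nat -> dual A) :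
  (forall j, (j < n)%N -> letter (c (+) odd j) (P j)) ->
  Phi (\prod_(0 <= j < n) P j) = 0.
Proof.
move=> hP.
suff key m : (m <= n)%N -> forall P' : nat -> dual A,
    (forall j, (j < m)%N -> letter (c (+) odd j) (P' j)) ->
    (forall j, (m <= j < n)%N -> letter0 (c (+) odd j) (P' j)) ->
    Phi (\prod_(0 <= j < n) P' j) = 0.
  by apply: (key n (leqnn n)) => // j /andP[nj jn]; move: (leq_trans jn nj); rewrite ltnn.
elim: m => [_ P' _ h0|m ih mn P' h h0]; first by apply: (@Phi_words0 _ c) => j jn; exact: h0.
have -> : \prod_(0 <= j < n) P' j =
    (\prod_(0 <= k < m) P' k) * P' m * \prod_(m.+1 <= k < n) P' k.
  rewrite -prod_slot//; apply: eq_bigr => k _; by case: eqP => [->|].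
apply: Phi_slot_closed => e e0.
have [Q hQ dQ] := letter_approx (h m (ltnSn m)) e0; exists Q => //.
rewrite -prod_slot//; apply: ih (ltnW mn) _ _ _ => j.
  by move=> jm; rewrite ltn_eqF//; apply: h; exact: ltnW.
move=> /andP[mj jn]; case: eqP => [->//|/eqP jm].
by apply: h0; rewrite jn ltn_neqAle eq_sym jm mj.
Qed.

Variables u v : dual A.
Hypothesis hu : letter true u.
Hypothesis hv : letter false v.

Fixpoint altword c n : dual A :=
  if n is m.+1 then (if c then u else v) * altword (~~ c) m else 1.

Lemma Phi_altword c n : Phi (altword c n) = 0.
Proof.
have -> : altword c n = \prod_(0 <= j < n) (if c (+) odd j then u else v).
  elim: n c => [|n ih] c; first by rewrite big_nil.
  rewrite big_nat_recl//= addbF ih; congr (_ * _).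
  by apply: eq_bigr => j _; rewrite /= addbN addNb.
by apply: (@Phi_words _ c) => j _; case: (c (+) odd j).
Qed.

Lemma altword_double n m : (u * v) ^+ n * altword true m = altword true (n.*2 + m).
Proof.
elim: n => [|n ih]; first by rewrite expr0 mul1r.
by rewrite doubleS !addSn exprS -mulrA ih /= mulrA.
Qed.

(** The dual numbers P such that Phi ((1 + v) (u v)^n P (1 + u)) = 0 for all n
    form a closed subspace that is invariant under left multiplication by u v.
    It contains 1, since every term of (1 + v) (u v)^n (1 + u) is an alternating
    word. *)
Lemma Phi_resolvent (Mr : R) :
  (forall z, 0 <= z <= 1 -> exists r,
    [/\ r * (1 - real_complex R z *: (u * v)) = 1,
        (1 - real_complex R z *: (u * v)) * r = 1 & dnrm r <= Mr]) ->
  forall r, (1 - u * v) * r = 1 -> Phi ((1 + v) * r * (1 + u)) = 0.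
Proof.
move=> inv r hr.
pose L P := forall n, Phi ((1 + v) * (u * v) ^+ n * P * (1 + u)) = 0.
suff : L (r * 1) by move=> /(_ 0%N); rewrite expr0 !mulr1.
apply: (@resolvent_continuation R (dual A) dnrm L _ _ _ _ _ _ _ (u * v) _ Mr inv r hr).
- exact: dnrm_ge0.
- exact: dnrmM.
- exact: dnrmZ.
- by move=> n; rewrite mulr0 mul0r -(subrr 1) PhiB subrr.
- by move=> P Q LP LQ n; rewrite [_ * (P + Q)]mulrDr [(_ + _) * (1 + u)]mulrDl PhiD LP LQ addr0.
- by move=> t P LP n; rewrite -scalerAr -scalerAl PhiZ LP scaler0.
- move=> P hP n; apply: Phi_slot_closed => e e0.
  by have [Q hQ dQ] := hP e e0; exists Q.
- by move=> P LP n; rewrite mulrA -[_ * _ * (u * v)]mulrA -exprSr; exact: LP.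
- move=> n; rewrite mulr1.
  have -> : (1 + v) * (u * v) ^+ n * (1 + u) =
    (u * v) ^+ n * altword true 0 + (u * v) ^+ n * altword true 1 +
    v * ((u * v) ^+ n * altword true 0) + v * ((u * v) ^+ n * altword true 1).
    by rewrite /= !mulr1; ncring.
  rewrite !altword_double -[v * altword true (_ + 0)]/(altword false (_ + 0).+1).
  rewrite -[v * altword true (_ + 1)]/(altword false (_ + 1).+1).
  by rewrite !PhiD !Phi_altword !addr0.
Qed.

End Words.
(** * Subordination *)

Section SubordinationBound.
Context {R : realType} {A : cstarAlgType R}.
Implicit Types P Q : A.

Lemma resolvent_sandwich (T : unitRingType) (a b c : T) :
  a \is a GRing.unit -> b \is a GRing.unit ->
  a * (a^-1 + b^-1 - c) * b = b + a - a * c * b.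
Proof.
move=> ua ub; rewrite mulrBr mulrDr mulrV// !mulrBl !mulrDl mul1r.
by rewrite -[a / b * b]mulrA mulVr// mulr1.
Qed.

(** In the application P is the image of F in A, Q1 = w1 b - x and
    Q2 = w2 b - y, so that Im Q1 + Im Q2 - Im P = Im b. *)
Lemma alternating_resolvent_bound P Q1 Q2 (e e1 e2 : R) :
  0 < e -> 0 < e1 -> 0 < e2 -> lbd e1 (cIm Q1) -> lbd e2 (cIm Q2) ->
  lbd 0 (cIm P - cIm Q1) -> lbd 0 (cIm P - cIm Q2) ->
  lbd e (cIm Q1 + cIm Q2 - cIm P) ->
  exists M, forall z, 0 <= z <= 1 ->
    let D := 1 - real_complex R z *: ((Q1^-1 * P - 1) * (Q2^-1 * P - 1)) in
    D \is a GRing.unit /\ nrm D^-1 <= M.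
Proof.
move=> e0 e10 e20 l1 l2 lP1 lP2 lPQ.
have [uP _] : P \is a GRing.unit /\ nrm P^-1 <= e1^-1.
  apply: cIm_lbd_unit => //; rewrite -[cIm P](subrK (cIm Q1)) -[e1]add0r.
  exact: lbdD.
have l0 Q : lbd 0 (cIm Q - cIm Q) by rewrite subrr; exact: lbd0.
have [M1 hM1] := disc_convex e10 l1 lP1 (l0 Q1).
have [M2 hM2] := disc_convex e20 l2 lP2 (l0 Q2).
(* Scaling u and v by s multiplies u v by s^2, hence the square root. *)
exists (nrm P^-1 * M2 * e^-1 * M1) => z z01 D; pose s := Num.sqrt z.
have /andP[z0 z1] := z01.
have s01 : 0 <= s <= 1 by rewrite sqrtr_ge0 -sqrtr1 ler_wsqrtr.
have ssz : s * s = z by rewrite -expr2 sqr_sqrtr.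
have [/= uX nX lX] := hM1 s s01; have [/= uY nY lY] := hM2 s s01.
set X := rsc (1 - s) * P^-1 + rsc s * Q1^-1 in uX nX lX.
set Y := rsc (1 - s) * P^-1 + rsc s * Q2^-1 in uY nY lY.
pose Z := X^-1 + Y^-1 - P.
have [uZ nZ] : Z \is a GRing.unit /\ nrm Z^-1 <= e^-1.
  apply: cIm_lbd_unit => //; rewrite -[e]add0r -[0]add0r.
  have -> : cIm Z = (cIm X^-1 - cIm Q1) + (cIm Y^-1 - cIm Q2) +
      (cIm Q1 + cIm Q2 - cIm P).
    by rewrite /Z cImB cImD; ncring.
  by apply: lbdD => //; exact: lbdD.
have slotE Q : (rsc (1 - s) * P^-1 + rsc s * Q^-1) * P = 1 + rsc s * (Q^-1 * P - 1).
  by rewrite mulrDl mulrBr -!mulrA mulVr// rscB rsc1; ncring.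
have DE : D = X * Z * Y * P.
  have -> : X * Z * Y * P = Y * P + X * P - X * P * (Y * P).
    by rewrite /Z resolvent_sandwich// mulrBl mulrDl !mulrA.
  rewrite /X /Y !slotE /D -mul_rscl -ssz rscM.
  set U := _ - 1; set V := _ - 1.
  have -> : rsc s * rsc s * (U * V) = rsc s * U * (rsc s * V).
    by rewrite -!mulrA [U * (rsc s * V)]mulrA -[U * rsc s]rscC -mulrA.
  by ncring.
split; first by rewrite DE !unitrMr// uX.
rewrite DE invrM ?unitrMr// invrM ?unitrMr// invrM// !mulrA.
have a0 := nrm_ge0 P^-1; have b0 := nrm_ge0 Y^-1; have c0 := nrm_ge0 Z^-1.
apply: le_trans (nrmM _ _) _; apply: ler_pM => //; try exact: nrm_ge0.
apply: le_trans (nrmM _ _) _; apply: ler_pM => //; try exact: nrm_ge0.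
apply: le_trans (nrmM _ _) _; apply: ler_pM => //.
Qed.

End SubordinationBound.

Section Subordination.
Context {R : realType} {A B : cstarAlgType R}.
Variables (iota : {lrmorphism B -> A}) (E E' : {linear A -> B}).
Hypothesis hOVI : COVI_space iota E E'.

Lemma COVI_bounded : exists2 M : R, 0 <= M &
  (forall a, nrm (E a) <= M * nrm a) /\ (forall a, nrm (E' a) <= M * nrm a).
Proof.
have [C hC] := E'_bounded hOVI.
have C0 : 0 <= C.
  by have := hC 1; rewrite (E'_1 hOVI) normr0 normE nrm1 rc1 mulr1.
have CE := RRe_real (ger0_real C0).
have c0 : 0 <= complex.Re C by rewrite -ler0c CE.
have E1 : E 1 = 1 by rewrite -(rmorph1 iota) (E_id hOVI).
exists (6 + complex.Re C); first by lra.
split=> a; have g := nrm_ge0 a.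
  have := completely_positive_bounded (E_cp hOVI) E1 a; nra.
have : nrm (E' a) <= complex.Re C * nrm a.
  by rewrite -lecR rcM CE -!normE; exact: hC.
nra.
Qed.

Lemma E_iotar a b : E (a * iota b) = E a * b.
Proof. by have := E_bimod hOVI 1 a b; rewrite rmorph1 !mul1r. Qed.

Lemma E'_iotar a b : E' (a * iota b) = E' a * b.
Proof. by have := E'_bimod hOVI 1 a b; rewrite rmorph1 !mul1r. Qed.

Variables x y : A.
Hypothesis xs : star x = x.
Hypothesis ys : star y = y.
Hypothesis hfree : inf_free iota E E' x y.

(** The imaginary part of F is Im w1 + (Im w2 - Im b) >= Im w1.  In particular
    the values of the Cauchy transforms at the points concerned are
    invertible. *)
Lemma subordination_unit (b w1 w2 F : B) :
  Hplus w1 -> cle (cIm b) (cIm w2) -> F + b = w1 + w2 -> F \is a GRing.unit.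
Proof.
move=> /HplusP[e e0 he] hb2 Fb.
have -> : F = w1 + w2 - b by rewrite -Fb addrK.
have h : lbd e (cIm (w1 + w2 - b)).
  rewrite cImB cImD -addrA -[e]addr0.
  by apply: lbdD => //; exact: cle_lbd.
by have [] := cIm_lbd_unit e0 h.
Qed.

(** These are the two components of (w + eps k - v)^-1 F - 1.  The condition on
    k is what makes the expectation of the eps-part equal to the value of E'
    on the other component. *)
Lemma letter_resolvent c (v : A) (w k F : B) : v = (if c then x else y) ->
  Hplus w -> Gtr iota E v w * F = 1 -> dGtr iota E v w k = gtr iota E' v w ->
  letter iota E E' x y c
   ((iota w - v)^-1 * iota F - 1,
    - ((iota w - v)^-1 * iota k * (iota w - v)^-1) * iota F).
Proof.
move=> vE hw GF hk.
have vs : star v = v by rewrite vE; case: c {vE}.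
have ni := iota_nrm hOVI.
have nX : nclosure (alg_gen iota v) (iota w - v)^-1.
  exact: (resolvent_nclosure ni (iota_star hOVI)).
have SE : (if c then alg_gen iota x else alg_gen iota y) = alg_gen iota v.
  by rewrite vE; case: c {vE}.
split; rewrite ?SE /=.
- apply: nclosure_alg_genD; last by apply/nclosure_alg_genN/sub_nclosure; exact: alg_gen1.
  by apply: nclosure_alg_genM => //; exact: nclosure_iota.
- apply: nclosure_alg_genM; last exact: nclosure_iota.
  apply/nclosure_alg_genN/nclosure_alg_genM => //; apply: nclosure_alg_genM => //; exact: nclosure_iota.
- have E1 : E 1 = 1 by rewrite -(rmorph1 iota) (E_id hOVI).
  by rewrite (linearB E) E_iotar E1 -/(Gtr iota E v w) GF subrr.
- rewrite (linearB E') E'_iotar (E'_1 hOVI) subr0 -/(gtr iota E' v w) -hk.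
  by rewrite E_iotar (linearN E).
Qed.

Lemma infinitesimal_subordination (b w1 w2 k1 k2 F : B) :
  Hplus b -> Hplus w1 -> Hplus w2 -> cle (cIm b) (cIm w1) -> cle (cIm b) (cIm w2) ->
  F + b = w1 + w2 -> Gtr iota E x w1 * F = 1 -> Gtr iota E y w2 * F = 1 ->
  dGtr iota E x w1 k1 = gtr iota E' x w1 -> dGtr iota E y w2 k2 = gtr iota E' y w2 ->
  gtr iota E' (x + y) b = dGtr iota E (x + y) b (k1 + k2).
Proof.
move=> hb hw1 hw2 lb1 lb2 Fb GF1 GF2 hk1 hk2.
have [M M0 [EN E'N]] := COVI_bounded.
have ni := iota_nrm hOVI; have si := iota_star hOVI.
have xys : star (x + y) = x + y by rewrite starD xs ys.
pose T1 := iota w1 - x; pose T2 := iota w2 - y; pose T := iota b - (x + y).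
have uT1 : T1 \is a GRing.unit by exact: resolvent_unit.
have uT2 : T2 \is a GRing.unit by exact: resolvent_unit.
have uT : T \is a GRing.unit by exact: resolvent_unit.
have Tsum : T1 + T2 - iota F = T.
  have -> : F = w1 + w2 - b by rewrite -Fb addrK.
  by rewrite (linearB iota) (linearD iota) /T1 /T2 /T; ncring.
have imT1 : cIm T1 = iota (cIm w1) by exact: cIm_iotaB.
have imT2 : cIm T2 = iota (cIm w2) by exact: cIm_iotaB.
have imT : cIm T = iota (cIm b) by exact: cIm_iotaB.
have imF : cIm (iota F) = cIm T1 + cIm T2 - cIm T.
  by rewrite -Tsum [cIm (_ - iota F)]cImB [cIm (T1 + T2)]cImD; ncring.
have [e1 e10 l1] := (HplusP w1).1 hw1; have [e2 e20 l2] := (HplusP w2).1 hw2.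
have [e e0 l0] := (HplusP b).1 hb.
have d1 : lbd 0 (cIm T1 - cIm T).
  by rewrite imT1 imT -linearB; apply: lbd_iota => //; exact: cle_lbd.
have d2 : lbd 0 (cIm T2 - cIm T).
  by rewrite imT2 imT -linearB; apply: lbd_iota => //; exact: cle_lbd.
have iF1 : cIm (iota F) - cIm T1 = cIm T2 - cIm T by rewrite imF; ncring.
have iF2 : cIm (iota F) - cIm T2 = cIm T1 - cIm T by rewrite imF; ncring.
have iF3 : cIm T1 + cIm T2 - cIm (iota F) = cIm T by rewrite imF; ncring.
have [|||||Mr hMr] := @alternating_resolvent_bound R A (iota F) T1 T2 _ _ _ e0 e10 e20.
- by rewrite imT1; exact: lbd_iota.
- by rewrite imT2; exact: lbd_iota.
- by rewrite iF1.
- by rewrite iF2.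
- by rewrite iF3 imT; exact: lbd_iota.
have uF : F \is a GRing.unit by exact: subordination_unit hw1 lb2 Fb.
pose G := F^-1; have FG : F * G = 1 by exact: mulrV.
have GF : G * F = 1 by exact: mulVr.
pose fh : dual A := (iota F, 0); pose gh : dual A := (iota G, 0).
have fgh : fh * gh = 1.
  apply/pair_eqP/andP; split; apply/eqP; rewrite !dualE /=.
    by rewrite -rmorphM FG rmorph1.
  by rewrite mulr0 mul0r addr0.
have [X [XT1 T1X X1 X2]] := @dual_inv R A (T1, iota k1) uT1.
have [Y [YT2 T2Y Y1 Y2]] := @dual_inv R A (T2, iota k2) uT2.
set Th1 : dual A := (T1, iota k1) in XT1 T1X X1 X2.
set Th2 : dual A := (T2, iota k2) in YT2 T2Y Y1 Y2.
pose Th := Th1 + Th2 - fh.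
have Th_1 : Th.1 = T by rewrite /Th !dualE.
have Th_2 : Th.2 = iota (k1 + k2) by rewrite /Th !dualE /= subr0 (linearD iota).
have [|r0 [r0T Tr0 r01 r02]] := @dual_inv R A Th; first by rewrite Th_1.
rewrite Th_1 Th_2 in r01 r02.
pose u := X * fh - 1; pose v := Y * fh - 1.
have lu : letter iota E E' x y true u.
  have -> : u = (T1^-1 * iota F - 1, - (T1^-1 * iota k1 * T1^-1) * iota F).
    by apply/pair_eqP/andP; split; apply/eqP; rewrite /u !dualE /= ?X1 ?X2// mulr0 add0r subr0.
  exact: letter_resolvent.
have lv : letter iota E E' x y false v.
  have -> : v = (T2^-1 * iota F - 1, - (T2^-1 * iota k2 * T2^-1) * iota F).
    by apply/pair_eqP/andP; split; apply/eqP; rewrite /v !dualE /= ?Y1 ?Y2// mulr0 add0r subr0.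
  exact: letter_resolvent.
(* The dual-number form of b - x - y = X^-1 (1 - u v) G Y^-1. *)
have uvE : 1 - u * v = X * Th * Y * fh.
  have -> : 1 - u * v = (Y + X - X * fh * Y) * fh by rewrite /u /v; ncring.
  have -> : X * Th * Y = X * Th1 * Y + X * (Th2 * Y) - X * fh * Y by rewrite /Th; ncring.
  by rewrite XT1 T2Y mul1r mulr1.
pose r := gh * Th2 * r0 * Th1.
have hr : (1 - u * v) * r = 1.
  rewrite uvE /r.
  have -> : X * Th * Y * fh * (gh * Th2 * r0 * Th1) =
    X * (Th * (Y * (fh * gh) * Th2) * r0) * Th1 by ncring.
  by rewrite fgh mulr1 YT2 mulr1 Tr0 mulr1 XT1.
(* r0 is the dual resolvent (b + eps (k1 + k2) - x - y)^-1. *)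
have vru : (1 + v) * r * (1 + u) = r0 * fh.
  have -> : (1 + v) * r * (1 + u) = Y * (fh * gh) * Th2 * r0 * (Th1 * X) * fh.
    by rewrite /u /v /r; ncring.
  by rewrite fgh mulr1 YT2 mul1r T1X mulr1.
pose Dz z : dual A := 1 - real_complex R z *: (u * v).
have inv z : 0 <= z <= 1 -> exists s : dual A,
    [/\ s * Dz z = 1, Dz z * s = 1 & dnrm s <= Mr + Mr * nrm (u * v).2 * Mr].
  move=> z01; have [uD nD] := hMr z z01.
  set D := 1 - _ in uD nD.
  have DE : (Dz z).1 = D.
    by rewrite /D /Dz !dualE X1 Y1.
  have [|s [sD Ds s1 s2]] := @dual_inv R A (Dz z); first by rewrite DE.
  exists s; split=> //; rewrite /dnrm s1 s2 DE; apply: lerD => //.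
  rewrite nrmN; apply: le_trans (nrmM _ _) _; apply: ler_pM => //; try exact: nrm_ge0.
  apply: le_trans (nrmM _ _) _; apply: ler_pM => //; try exact: nrm_ge0.
  have -> : (Dz z).2 = - (real_complex R z *: (u * v).2).
    by rewrite /Dz dual_add2E dual_opp2E dual_scale2E sub0r.
  have /andP[z0 z1] := z01.
  by rewrite nrmN nrmZr ger0_norm// ler_piMl// nrm_ge0.
have := Phi_resolvent hOVI M0 EN E'N hfree lu lv inv hr.
rewrite vru /Phi !dualE /= mulr0 add0r !E'_iotar !E_iotar -mulrBl.
move=> h; have /subr0_eq : E' r0.1 - E r0.2 = 0.
  by rewrite -[LHS]mulr1 -FG mulrA h mul0r.
by rewrite r01 r02 (linearN E).
Qed.

End Subordination.

Theorem theorem4p7 (R : realType) (A B : cstarAlgType R)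
  (iota : {lrmorphism B -> A}) (E E' : {linear A -> B})
  (hOVI : COVI_space iota E E')
  (x y : A) (hx : star x = x) (hy : star y = y)
  (hfree : inf_free iota E E' x y)
  (w1 w2 : B -> B) (hw : subordination iota E x y w1 w2)
  (b : B) (hb : Hplus b)
  (dGinv : B -> B)
  (hdGinv : comp_inverse ('d (Gtr iota E (x + y)) b) dGinv) :
  gtr iota E' (x + y) b =
    ('d (Gtr iota E (x + y)) b \o 'd w1 b \o dGinv) (gtr iota E' x (w1 b)) +
    ('d (Gtr iota E (x + y)) b \o 'd w2 b \o dGinv) (gtr iota E' y (w2 b)).
Proof.
have [hp1 hp2 an1 an2 im1 im2 F1 F2 G1 G2] := hw.
have [_ dGK] := hdGinv.
have ni := iota_nrm hOVI; have si := iota_star hOVI.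
have E1 : E 1 = 1 by rewrite -(rmorph1 iota) (E_id hOVI).
have EN := completely_positive_bounded (E_cp hOVI) E1.
have ru c v : Hplus c -> star v = v -> iota c - v \is a GRing.unit.
  by move=> hc vs; exact: (resolvent_unit ni si).
have chain v w c : star v = v -> (forall z, Hplus z -> Hplus (w z)) ->
    differentiable w b ->
    (forall z, Hplus z -> Gtr iota E v (w z) = Gtr iota E (x + y) z) ->
    dGtr iota E v (w b) ('d w b (dGinv c)) = c.
  move=> vs hw' dw hG; rewrite -[RHS]dGK.
  have uT : iota (w b) - v \is a GRing.unit by exact: ru (hw' _ hb) vs.
  have dGv := differentiable_Gtr ni EN uT.
  have dc : differentiable (Gtr iota E v \o w) b by exact: differentiable_comp.
  have nE : \forall z \near b, (Gtr iota E v \o w) z = Gtr iota E (x + y) z.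
    by apply: filterS (near_Hplus hb) => z /hG.
  have e1 := near_eq_diff nE dc.
  have e2 := diff_comp dw dGv.
  have e3 := diff_Gtr ni EN uT.
  pose h := dGinv c.
  have c1 := congr1 (fun f => f h) e1.
  have c2 := congr1 (fun f => f h) e2.
  have c3 := congr1 (fun f => f ('d w b h)) e3.
  exact: esym (etrans c1 (etrans c2 c3)).
have uF : Ftr iota E x (w1 b) \is a GRing.unit.
  exact: subordination_unit (hp1 b hb) (im2 b hb) (F1 b hb).
have GF : Gtr iota E x (w1 b) * Ftr iota E x (w1 b) = 1.
  by move: uF; rewrite /Ftr unitrV => uG; exact: mulrV.
rewrite /= -linearD.
have xys : star (x + y) = x + y by rewrite starD hx hy.
have dG := diff_Gtr ni EN (ru _ _ hb xys).
apply: etrans (esym (congr1 (fun f => f _) dG)).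
have GF2 : Gtr iota E y (w2 b) * Ftr iota E x (w1 b) = 1.
  by rewrite (G2 _ hb) -(G1 _ hb).
exact: (infinitesimal_subordination hOVI hx hy hfree hb (hp1 b hb) (hp2 b hb)
  (im1 b hb) (im2 b hb) (F1 b hb) GF GF2
  (chain _ _ _ hx hp1 (an1 b hb) G1) (chain _ _ _ hy hp2 (an2 b hb) G2)).
Qed.
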